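(* Let $(F,E,L)$ be a $\sigma$-admissible triple. The category $\mathrm{Phi}^L_E$ of $L$-trivial $\varphi$-modules over $E$ is a neutral Tannakian category over $F$, and the functor $V:\mathrm{Phi}^L_E\to\mathrm{Vec}(F)$, $M\mapsto (L\otimes_EM)^{\varphi}$, is a fiber functor for it.
   Context: A $\sigma$-admissible triple $(F,E,L)$ consists of a positive integer $d$, rings $F\subset E\subset L$ with $F,E$ fields and $L=\prod_{l\in\mathbb{Z}/d}L_l$ a finite product of fields, and a ring endomorphism $\sigma:L\to L$ with $\sigma(E)\subset E$, $\sigma(L_l)\subset L_{l+1}$, $F=E^\sigma=L^\sigma$, and $L$ separable over $E$. A $\varphi$-module over $E$ is an $E$-vector space $M$ with an additive map $\varphi:M\to M$ such that $\varphi(ax)=\sigma(a)\varphi(x)$; morphisms are $E$-linear maps commuting with $\varphi$; tensor product is $M\otimes_EN$ with $\varphi\otimes\varphi$, unit object $(E,\sigma)$. $V(M):=(L\otimes_EM)^{\varphi}$, where $\varphi$ acts on $L\otimes_EM$ as $\sigma\otimes\varphi$. $M$ is $L$-trivial if $\dim_EM<\infty$ and the natural map $L\otimes_FV(M)\to L\otimes_EM$ is an isomorphism. $\mathrm{Vec}(F)$ is the category of finite-dimensional $F$-vector spaces. A neutral Tannakian category over $F$ is a rigid abelian $F$-linear tensor category with $F\cong\mathrm{End}(\mathbf 1)$ admitting an exact faithful $F$-linear tensor functor (fiber functor) to $\mathrm{Vec}(F)$. *)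

(* Defs.v *)
From HB Require Import structures.
From mathcomp Require Import all_boot all_order all_algebra.
From mathcomp Require Import mathcomp_extra boolp classical_sets functions.

Set Implicit Arguments.
Unset Strict Implicit.
Unset Printing Implicit Defensive.

Import GRing.Theory.
Local Open Scope ring_scope.
Local Open Scope quotient_scope.

(* Restriction of scalars along f. *)
Definition restr (R S : nzRingType) (f : {rmorphism R -> S}) (M : lmodType S) :
  Type := M.

Section Restr.
Variables (R S : nzRingType) (f : {rmorphism R -> S}) (M : lmodType S).

HB.instance Definition _ := GRing.Zmodule.copy (restr f M) M.

Definition restr_scale (a : R) (x : restr f M) : restr f M := f a *: (x : M).

Fact restr_scalerA a b x :
  restr_scale a (restr_scale b x) = restr_scale (a * b) x.
Proof. by rewrite /restr_scale scalerA rmorphM. Qed.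
Fact restr_scale1r : left_id 1 restr_scale.
Proof. by move=> x; rewrite /restr_scale rmorph1 scale1r. Qed.
Fact restr_scalerDr : right_distributive restr_scale +%R.
Proof. by move=> a x y; rewrite /restr_scale scalerDr. Qed.
Fact restr_scalerDl x : {morph restr_scale^~ x : a b / a + b}.
Proof. by move=> a b; rewrite /restr_scale rmorphD scalerDl. Qed.

HB.instance Definition _ := GRing.Zmodule_isLmodule.Build R (restr f M)
  restr_scalerA restr_scale1r restr_scalerDr restr_scalerDl.
End Restr.

Record submod (R : nzRingType) (V : lmodType R) (S : submodClosed V) : Type :=
  Submod { submod_val :> V; _ : submod_val \in S }.

Section SubmodTheory.
Variables (R : nzRingType) (V : lmodType R) (S : submodClosed V).
HB.instance Definition _ := [isSub of submod S for @submod_val R V S].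
HB.instance Definition _ := [Choice of submod S by <:].
HB.instance Definition _ := [SubChoice_isSubLmodule of submod S by <:].
End SubmodTheory.

(* Tensor product of modules over a commutative ring, as formal sums of pairs
   modulo the pairs of sums identified by every balanced biadditive map. *)
Definition balanced (K : comNzRingType) (M N : lmodType K) (W : zmodType)
    (b : M -> N -> W) : Prop :=
  [/\ forall y, {morph b^~ y : x x' / x + x'},
      forall x, {morph b x : y y' / y + y'}
    & forall a x y, b (a *: x) y = b x (a *: y)].

Section Tensor.
Variables (K : comNzRingType) (M N : lmodType K).

Definition tsum (W : zmodType) (b : M -> N -> W) (s : seq (M * N)) : W :=
  \sum_(p <- s) b p.1 p.2.

Definition tens_rel (s t : seq (M * N)) : bool :=
  `[< forall (W : zmodType) (b : M -> N -> W),
        balanced b -> tsum b s = tsum b t >].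

Fact tens_rel_refl : reflexive tens_rel.
Proof. by move=> s; apply/asboolP. Qed.
Fact tens_rel_sym : symmetric tens_rel.
Proof. by move=> s t; apply/asboolP/asboolP => h W b /h. Qed.
Fact tens_rel_trans : transitive tens_rel.
Proof.
by move=> t s u /asboolP h /asboolP k; apply/asboolP=> W b bb; rewrite h ?k.
Qed.

Canonical tens_equiv :=
  EquivRel tens_rel tens_rel_refl tens_rel_sym tens_rel_trans.

Definition tens : Type := {eq_quot tens_equiv}.
HB.instance Definition _ := Choice.on tens.

Definition tens_of (s : seq (M * N)) : tens := \pi_{eq_quot tens_equiv} s.
Definition tens_repr (t : tens) : seq (M * N) :=
  repr (t : {eq_quot tens_equiv}).

Fact tens_ofK : cancel tens_repr tens_of.
Proof. by move=> t; rewrite /tens_of /tens_repr reprK. Qed.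

Fact tens_ofP s t :
  (forall (W : zmodType) (b : M -> N -> W),
     balanced b -> tsum b s = tsum b t) -> tens_of s = tens_of t.
Proof. by move=> h; apply/eqmodP/asboolP. Qed.

Fact tsum_repr (W : zmodType) (b : M -> N -> W) s :
  balanced b -> tsum b (tens_repr (tens_of s)) = tsum b s.
Proof.
move=> bb; have /eqmodP/asboolP : tens_of (tens_repr (tens_of s)) = tens_of s.
  exact: tens_ofK.
exact.
Qed.

Fact tsum_cat (W : zmodType) (b : M -> N -> W) s t :
  tsum b (s ++ t) = tsum b s + tsum b t.
Proof. exact: big_cat. Qed.

Definition tens_zero : tens := tens_of [::].
Definition tens_opp (t : tens) : tens :=
  tens_of [seq (- p.1, p.2) | p <- tens_repr t].
Definition tens_add (s t : tens) : tens := tens_of (tens_repr s ++ tens_repr t).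
Definition tens_scale (a : K) (t : tens) : tens :=
  tens_of [seq (a *: p.1, p.2) | p <- tens_repr t].

Fact balanced0 (W : zmodType) (b : M -> N -> W) y : balanced b -> b 0 y = 0.
Proof. by case=> bD _ _; apply: (addIr (b 0 y)); rewrite -bD !add0r. Qed.
Fact balancedN (W : zmodType) (b : M -> N -> W) x y :
  balanced b -> b (- x) y = - b x y.
Proof.
move=> bb; apply: (addIr (b x y)); case: (bb) => bD _ _.
by rewrite -bD !addNr balanced0.
Qed.

Fact tsum_opp (W : zmodType) (b : M -> N -> W) s : balanced b ->
  tsum b [seq (- p.1, p.2) | p <- s] = - tsum b s.
Proof.
move=> bb; rewrite /tsum big_map -sumrN; apply: eq_bigr => p _.
by rewrite balancedN.
Qed.

Fact balanced_scale a (W : zmodType) (b : M -> N -> W) :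
  balanced b -> balanced (fun x y => b (a *: x) y).
Proof.
case=> bD bD' bZ; split=> [y x x'|x y y'|c x y]; first by rewrite scalerDr bD.
  exact: bD'.
by rewrite !bZ !scalerA mulrC.
Qed.

Fact tsum_scale a (W : zmodType) (b : M -> N -> W) s :
  tsum b [seq (a *: p.1, p.2) | p <- s] = tsum (fun x y => b (a *: x) y) s.
Proof. exact: big_map. Qed.

Fact tens_addA : associative tens_add.
Proof.
move=> r s t; apply: tens_ofP => W b bb.
by rewrite !(tsum_cat, tsum_repr) // addrA.
Qed.
Fact tens_addC : commutative tens_add.
Proof.
by move=> s t; apply: tens_ofP => W b bb; rewrite !tsum_cat addrC.
Qed.
Fact tens_add0 : left_id tens_zero tens_add.
Proof.
move=> t; rewrite -[RHS]tens_ofK; apply: tens_ofP => W b bb.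
by rewrite tsum_cat tsum_repr // [tsum _ [::]]big_nil add0r.
Qed.
Fact tens_addN : left_inverse tens_zero tens_opp tens_add.
Proof.
move=> t; apply: tens_ofP => W b bb.
by rewrite tsum_cat tsum_repr // tsum_opp // addNr [RHS]big_nil.
Qed.

HB.instance Definition _ :=
  GRing.isZmodule.Build tens tens_addA tens_addC tens_add0 tens_addN.

Fact tens_scalerA a b t :
  tens_scale a (tens_scale b t) = tens_scale (a * b) t.
Proof.
apply: tens_ofP => W f bf; rewrite !tsum_scale.
rewrite tsum_repr ?tsum_scale; last exact: balanced_scale.
by apply: eq_bigr => p _; rewrite scalerA.
Qed.
Fact tens_scale1r : left_id 1 tens_scale.
Proof.
move=> t; rewrite -[RHS]tens_ofK; apply: tens_ofP => W f bf.
by rewrite tsum_scale; apply: eq_bigr => p _; rewrite scale1r.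
Qed.
Fact tens_scalerDr : right_distributive tens_scale +%R.
Proof.
move=> a s t; apply: tens_ofP => W f bf; have bfa := balanced_scale a bf.
by rewrite !(tsum_scale, tsum_cat, tsum_repr).
Qed.
Fact tens_scalerDl t : {morph tens_scale^~ t : a b / a + b}.
Proof.
move=> a b; apply: tens_ofP => W f bf.
rewrite !(tsum_scale, tsum_cat, tsum_repr) // -big_split /=.
by apply: eq_bigr => p _; case: bf => bD _ _; rewrite scalerDl bD.
Qed.

HB.instance Definition _ := GRing.Zmodule_isLmodule.Build K tens
  tens_scalerA tens_scale1r tens_scalerDr tens_scalerDl.

Definition tpure (x : M) (y : N) : tens := tens_of [:: (x, y)].

(* Additive extension of x (x) y |-> b x y, meaningful when b is balanced. *)
Definition tens_lift (W : zmodType) (b : M -> N -> W) (t : tens) : W :=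
  tsum b (tens_repr t).

Lemma tens_lift_tpure (W : zmodType) (b : M -> N -> W) x y :
  balanced b -> tens_lift b (tpure x y) = b x y.
Proof.
by move=> bb; rewrite /tens_lift tsum_repr // /tsum big_seq1.
Qed.

Lemma tens_liftD (W : zmodType) (b : M -> N -> W) :
  balanced b -> {morph tens_lift b : s t / s + t}.
Proof. by move=> bb s t; rewrite /tens_lift tsum_repr // tsum_cat. Qed.

Lemma balanced_tpure : balanced tpure.
Proof.
split=> [y x x'|x y y'|a x y]; apply: tens_ofP => W b [bD bD' bZ];
  by rewrite ?tsum_cat ?tsum_repr // /tsum !big_seq1 /= ?bD ?bD' ?bZ.
Qed.

Lemma tpureDl y : {morph tpure^~ y : x x' / x + x'}.
Proof. by case: balanced_tpure. Qed.
Lemma tpureDr x : {morph tpure x : y y' / y + y'}.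
Proof. by case: balanced_tpure. Qed.

Lemma tpureZl a x y : tpure (a *: x) y = a *: tpure x y.
Proof.
apply: tens_ofP => W b bb; rewrite tsum_scale.
by rewrite tsum_repr; [rewrite /tsum !big_seq1 | exact: balanced_scale].
Qed.

Lemma tpureZr a x y : tpure x (a *: y) = a *: tpure x y.
Proof. by case: balanced_tpure => _ _ <-; rewrite tpureZl. Qed.

Lemma tens_ind (P : tens -> Prop) :
  P 0 -> (forall x y, P (tpure x y)) ->
  (forall s t, P s -> P t -> P (s + t)) -> forall t, P t.
Proof.
move=> P0 Pp PD t; rewrite -[t]tens_ofK.
elim: (tens_repr t) => [//|[x y] s IHs].
suff -> : tens_of ((x, y) :: s) = tpure x y + tens_of s by apply: PD.
apply: tens_ofP => W b bb; rewrite tsum_cat !tsum_repr //.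
by rewrite -[_ :: s]cat1s tsum_cat.
Qed.
End Tensor.

Section TensExtra.
Variables (K : comNzRingType) (M N : lmodType K).

Lemma tens_liftDf (W : zmodType) (b b1 b2 : M -> N -> W) t :
  (forall x y, b x y = b1 x y + b2 x y) ->
  tens_lift b t = tens_lift b1 t + tens_lift b2 t.
Proof.
move=> h; rewrite /tens_lift /tsum -big_split.
by apply: eq_bigr => p _; apply: h.
Qed.

Lemma tens_liftZf (V : lmodType K) (b b1 : M -> N -> V) a t :
  (forall x y, b x y = a *: b1 x y) -> tens_lift b t = a *: tens_lift b1 t.
Proof.
move=> h; rewrite /tens_lift /tsum scaler_sumr.
by apply: eq_bigr => p _; apply: h.
Qed.

Lemma tens_ext (W : zmodType) (f g : tens M N -> W) :
  {morph f : s t / s + t} -> {morph g : s t / s + t} ->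
  (forall x y, f (tpure x y) = g (tpure x y)) -> f =1 g.
Proof.
have f0 (h : tens M N -> W) : {morph h : s t / s + t} -> h 0 = 0.
  by move=> hD; apply: (addIr (h 0)); rewrite -hD !add0r.
move=> fD gD fg; elim/tens_ind=> [|//|s t IHs IHt]; first by rewrite !f0.
by rewrite fD gD IHs IHt.
Qed.
End TensExtra.

Section TensExt3.
Variables (K : comNzRingType) (M N P : lmodType K) (W : zmodType).

Lemma tens_ext3l (f g : tens (tens M N) P -> W) :
  {morph f : s t / s + t} -> {morph g : s t / s + t} ->
  (forall x y z, f (tpure (tpure x y) z) = g (tpure (tpure x y) z)) -> f =1 g.
Proof.
move=> fD gD fg; apply: tens_ext => // t z; move: t.
by apply: tens_ext => [s t|s t|x y]; rewrite ?tpureDl.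
Qed.

Lemma tens_ext3r (f g : tens M (tens N P) -> W) :
  {morph f : s t / s + t} -> {morph g : s t / s + t} ->
  (forall x y z, f (tpure x (tpure y z)) = g (tpure x (tpure y z))) -> f =1 g.
Proof.
move=> fD gD fg; apply: tens_ext => // x.
by apply: tens_ext => [s t|s t|y z]; rewrite ?tpureDr.
Qed.
End TensExt3.

Definition semilinear_for (K K' : nzRingType) (s : K -> K') (M : lmodType K)
    (N : lmodType K') (f : M -> N) : Prop :=
  {morph f : x y / x + y} /\ forall a x, f (a *: x) = s a *: f x.

Lemma semilinear_forP (K : nzRingType) (M N : lmodType K) (f : M -> N) :
  semilinear_for id f <-> linear f.
Proof.
split=> [[fD fZ] a x y|fl]; first by rewrite fD fZ.
have fD : {morph f : x y / x + y} by move=> x y; rewrite -[x]scale1r fl !scale1r.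
have f0 : f 0 = 0 by apply: (addIr (f 0)); rewrite -fD !add0r.
by split=> // a x; rewrite -[a *: x]addr0 fl f0 addr0.
Qed.

Definition tens_map (K K' : comNzRingType) (M N : lmodType K)
    (M' N' : lmodType K') (f : M -> M') (g : N -> N') : tens M N -> tens M' N' :=
  tens_lift (fun x y => tpure (f x) (g y)).

Section TensMap.
Variables (K K' : comNzRingType) (s : K -> K').
Variables (M N : lmodType K) (M' N' : lmodType K') (f : M -> M') (g : N -> N').
Hypotheses (fs : semilinear_for s f) (gs : semilinear_for s g).

Lemma tens_map_balanced : balanced (fun x y => tpure (f x) (g y)).
Proof.
case: fs gs => fD fZ [gD gZ]; split=> [y x x'|x y y'|a x y].
- by rewrite fD tpureDl.
- by rewrite gD tpureDr.
- by rewrite fZ gZ tpureZl tpureZr.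
Qed.

Lemma tens_map_tpure x y : tens_map f g (tpure x y) = tpure (f x) (g y).
Proof. by rewrite /tens_map tens_lift_tpure //; exact: tens_map_balanced. Qed.

Lemma tens_mapD : {morph tens_map f g : x y / x + y}.
Proof. exact: tens_liftD tens_map_balanced. Qed.

Lemma tens_map_semi : semilinear_for s (tens_map f g).
Proof.
split=> [|a]; first exact: tens_mapD.
apply: tens_ext => [x y|x y|x y].
- by rewrite scalerDr tens_mapD.
- by rewrite tens_mapD scalerDr.
- by rewrite -tpureZl !tens_map_tpure (proj2 fs) tpureZl.
Qed.
End TensMap.

Lemma tens_lift_semi (K : comNzRingType) (M N P : lmodType K)
    (b : M -> N -> P) :
  balanced b -> (forall a x y, b (a *: x) y = a *: b x y) ->
  semilinear_for id (tens_lift b).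
Proof.
move=> bb bZ; split=> [|a]; first exact: tens_liftD.
apply: tens_ext => [x y|x y|x y].
- by rewrite scalerDr tens_liftD.
- by rewrite tens_liftD // scalerDr.
- by rewrite -tpureZl !tens_lift_tpure.
Qed.

Section TensConstraints.
Variables (K : comNzRingType) (M N P : lmodType K).

Definition tens_assoc : tens (tens M N) P -> tens M (tens N P) :=
  tens_lift (fun t z => tens_lift (fun x y => tpure x (tpure y z)) t).
Definition tens_assocV : tens M (tens N P) -> tens (tens M N) P :=
  tens_lift (fun x t => tens_lift (fun y z => tpure (tpure x y) z) t).
Definition tens_swap : tens M N -> tens N M :=
  tens_lift (fun x y => tpure y x).
Definition tens_lunit : tens K^o M -> M :=
  tens_lift (fun (a : K^o) x => (a : K) *: x).
Definition tens_runit : tens M K^o -> M :=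
  tens_lift (fun x (a : K^o) => (a : K) *: x).

Fact tens_assoc_bal0 z :
  balanced (fun (x : M) (y : N) => tpure x (tpure y z : tens N P)).
Proof.
split=> [y x x'|x y y'|a x y]; first by rewrite tpureDl.
  by rewrite tpureDl tpureDr.
by rewrite !tpureZl !tpureZr.
Qed.

Fact tens_assoc_semi0 z : semilinear_for id
  (tens_lift (fun (x : M) (y : N) => tpure x (tpure y z : tens N P))).
Proof.
apply: tens_lift_semi; first exact: tens_assoc_bal0.
by move=> a x y; rewrite tpureZl.
Qed.

Fact tens_assoc_bal : balanced (fun t z =>
  tens_lift (fun (x : M) (y : N) => tpure x (tpure y z : tens N P)) t).
Proof.
split=> [z s t|t z z'|a t z].
- by rewrite (proj1 (tens_assoc_semi0 z)).
- by apply: tens_liftDf => x y; rewrite !tpureDr.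
- rewrite (proj2 (tens_assoc_semi0 z)); symmetry.
  by apply: tens_liftZf => x y; rewrite !tpureZr.
Qed.

Lemma tens_assoc_tpure x y z :
  tens_assoc (tpure (tpure x y) z) = tpure x (tpure y z).
Proof.
rewrite /tens_assoc tens_lift_tpure ?tens_lift_tpure //.
  exact: tens_assoc_bal0.
exact: tens_assoc_bal.
Qed.

Lemma tens_assoc_semi : semilinear_for id tens_assoc.
Proof.
apply: tens_lift_semi tens_assoc_bal _ => a t z.
exact: (proj2 (tens_assoc_semi0 z)).
Qed.

Fact tens_assocV_bal0 x :
  balanced (fun (y : N) (z : P) => tpure (tpure x y : tens M N) z).
Proof.
split=> [z y y'|y z z'|a y z]; first by rewrite tpureDr tpureDl.
  by rewrite tpureDr.
by rewrite tpureZr tpureZl tpureZr.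
Qed.

Fact tens_assocV_semi0 x : semilinear_for id
  (tens_lift (fun (y : N) (z : P) => tpure (tpure x y : tens M N) z)).
Proof.
apply: tens_lift_semi; first exact: tens_assocV_bal0.
by move=> a y z; rewrite tpureZr tpureZl.
Qed.

Fact tens_assocV_bal : balanced (fun x t =>
  tens_lift (fun (y : N) (z : P) => tpure (tpure x y : tens M N) z) t).
Proof.
split=> [t x x'|x s t|a x t].
- by apply: tens_liftDf => y z; rewrite !tpureDl.
- by rewrite (proj1 (tens_assocV_semi0 x)).
- rewrite (proj2 (tens_assocV_semi0 x)).
  by apply: tens_liftZf => y z; rewrite !tpureZl.
Qed.

Lemma tens_assocV_tpure x y z :
  tens_assocV (tpure x (tpure y z)) = tpure (tpure x y) z.
Proof.
rewrite /tens_assocV tens_lift_tpure ?tens_lift_tpure //.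
  exact: tens_assocV_bal0.
exact: tens_assocV_bal.
Qed.

Lemma tens_assocV_semi : semilinear_for id tens_assocV.
Proof.
apply: tens_lift_semi tens_assocV_bal _ => a x t.
by apply: tens_liftZf => y z; rewrite !tpureZl.
Qed.

Fact tens_swap_bal : balanced (fun (x : M) (y : N) => tpure y x).
Proof.
split=> [y x x'|x y y'|a x y]; first by rewrite tpureDr.
  by rewrite tpureDl.
by rewrite tpureZl tpureZr.
Qed.

Lemma tens_swap_tpure x y : tens_swap (tpure x y) = tpure y x.
Proof. exact: tens_lift_tpure tens_swap_bal. Qed.

Lemma tens_swap_semi : semilinear_for id tens_swap.
Proof.
by apply: tens_lift_semi tens_swap_bal _ => a x y; rewrite tpureZr.
Qed.

Fact tens_lunit_bal : balanced (fun (a : K^o) (x : M) => (a : K) *: x).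
Proof.
split=> [y x x'|x y y'|a x y]; first by rewrite scalerDl.
  by rewrite scalerDr.
by rewrite scalerA mulrC.
Qed.

Lemma tens_lunit_tpure a x : tens_lunit (tpure a x) = (a : K) *: x.
Proof. exact: tens_lift_tpure tens_lunit_bal. Qed.

Lemma tens_lunit_semi : semilinear_for id tens_lunit.
Proof.
by apply: tens_lift_semi tens_lunit_bal _ => a x y; rewrite scalerA.
Qed.

Fact tens_runit_bal : balanced (fun (x : M) (a : K^o) => (a : K) *: x).
Proof.
split=> [y x x'|x y y'|a x y]; first by rewrite scalerDr.
  by rewrite scalerDl.
by rewrite !scalerA mulrC.
Qed.

Lemma tens_runit_tpure x a : tens_runit (tpure x a) = (a : K) *: x.
Proof. exact: tens_lift_tpure tens_runit_bal. Qed.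

Lemma tens_runit_semi : semilinear_for id tens_runit.
Proof.
by apply: tens_lift_semi tens_runit_bal _ => a x y; rewrite !scalerA mulrC.
Qed.
End TensConstraints.

Record lincat (F : fieldType) := LinCat {
  ob :> Type;
  hom : ob -> ob -> lmodType F;
  idm : forall X, hom X X;
  ccomp : forall X Y Z, hom Y Z -> hom X Y -> hom X Z;
  ccomp1m : forall X Y (f : hom X Y), ccomp (idm Y) f = f;
  ccompm1 : forall X Y (f : hom X Y), ccomp f (idm X) = f;
  ccompA : forall X Y Z T (h : hom Z T) (g : hom Y Z) (f : hom X Y),
    ccomp h (ccomp g f) = ccomp (ccomp h g) f;
  ccomp_linearl : forall X Y Z (f : hom X Y),
    linear (fun g : hom Y Z => ccomp g f);
  ccomp_linearr : forall X Y Z (g : hom Y Z),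
    linear (fun f : hom X Y => ccomp g f) }.

Arguments hom {F l} X Y.
Arguments idm {F l} X.
Arguments ccomp {F l X Y Z} g f.

Notation "g \oc f" := (ccomp g f) (at level 45, left associativity).

Section Categories.
Variables (F : fieldType) (C : lincat F).
Implicit Types X Y Z W : C.

Definition is_iso X Y (f : hom X Y) : Prop :=
  exists g : hom Y X, g \oc f = idm X /\ f \oc g = idm Y.

Definition is_mono X Y (f : hom X Y) : Prop :=
  forall W (g h : hom W X), f \oc g = f \oc h -> g = h.

Definition is_epi X Y (f : hom X Y) : Prop :=
  forall W (g h : hom Y W), g \oc f = h \oc f -> g = h.

Definition is_kernel X Y Z (k : hom X Y) (f : hom Y Z) : Prop :=
  f \oc k = 0 /\
  forall W (g : hom W Y), f \oc g = 0 -> exists! h : hom W X, k \oc h = g.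

Definition is_cokernel X Y Z (c : hom Y Z) (f : hom X Y) : Prop :=
  c \oc f = 0 /\
  forall W (g : hom Y W), g \oc f = 0 -> exists! h : hom Z W, h \oc c = g.

Definition is_zero_object X : Prop :=
  (forall Y (f : hom X Y), f = 0) /\ (forall Y (f : hom Y X), f = 0).

Definition is_biproduct X Y Z (i1 : hom X Z) (i2 : hom Y Z)
    (p1 : hom Z X) (p2 : hom Z Y) : Prop :=
  [/\ p1 \oc i1 = idm X, p2 \oc i2 = idm Y, p1 \oc i2 = 0, p2 \oc i1 = 0
    & i1 \oc p1 + i2 \oc p2 = idm Z].

Record is_abelian : Prop := IsAbelian {
  abelian_zero : exists X, is_zero_object X;
  abelian_biproduct : forall X Y, exists Z (i1 : hom X Z) (i2 : hom Y Z)
    (p1 : hom Z X) (p2 : hom Z Y), is_biproduct i1 i2 p1 p2;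
  abelian_kernel : forall Y Z (f : hom Y Z),
    exists X (k : hom X Y), is_kernel k f;
  abelian_cokernel : forall X Y (f : hom X Y),
    exists Z (c : hom Y Z), is_cokernel c f;
  abelian_mono : forall X Y (k : hom X Y), is_mono k ->
    exists Z (f : hom Y Z), is_kernel k f;
  abelian_epi : forall Y Z (c : hom Y Z), is_epi c ->
    exists X (f : hom X Y), is_cokernel c f }.

(* 0 -> X -> Y -> Z -> 0 is exact. *)
Definition short_exact X Y Z (f : hom X Y) (g : hom Y Z) : Prop :=
  is_kernel f g /\ is_cokernel g f.

Record tensor_data := TensorData {
  tob : C -> C -> C;
  tmor : forall X X' Y Y',
    hom X X' -> hom Y Y' -> hom (tob X Y) (tob X' Y');
  tone : C;
  tass : forall X Y Z, hom (tob (tob X Y) Z) (tob X (tob Y Z));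
  tassV : forall X Y Z, hom (tob X (tob Y Z)) (tob (tob X Y) Z);
  tbraid : forall X Y, hom (tob X Y) (tob Y X);
  tlunit : forall X, hom (tob tone X) X;
  trunit : forall X, hom (tob X tone) X }.

Section TensorAxioms.
Variable T : tensor_data.

Local Notation "X ** Y" := (tob T X Y) (at level 40, left associativity).
Local Notation "f *** g" := (tmor T f g) (at level 40, left associativity).
Local Notation one := (tone T).

(* F-linear symmetric monoidal structure. *)
Record is_tensor_category : Prop := IsTensorCategory {
  tmor1 : forall X Y, idm X *** idm Y = idm (X ** Y);
  tmorM : forall X X' X'' Y Y' Y'' (f : hom X X') (f' : hom X' X'')
    (g : hom Y Y') (g' : hom Y' Y''),
    (f' \oc f) *** (g' \oc g) = (f' *** g') \oc (f *** g);
  tmor_linearl : forall X X' Y Y' (g : hom Y Y'),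
    linear (fun f : hom X X' => f *** g);
  tmor_linearr : forall X X' Y Y' (f : hom X X'),
    linear (fun g : hom Y Y' => f *** g);
  tass_natural : forall X X' Y Y' Z Z'
    (f : hom X X') (g : hom Y Y') (h : hom Z Z'),
    tass T X' Y' Z' \oc ((f *** g) *** h) =
    (f *** (g *** h)) \oc tass T X Y Z;
  tbraid_natural : forall X X' Y Y' (f : hom X X') (g : hom Y Y'),
    tbraid T X' Y' \oc (f *** g) = (g *** f) \oc tbraid T X Y;
  tlunit_natural : forall X X' (f : hom X X'),
    tlunit T X' \oc (idm one *** f) = f \oc tlunit T X;
  trunit_natural : forall X X' (f : hom X X'),
    trunit T X' \oc (f *** idm one) = f \oc trunit T X;
  tassK : forall X Y Z, tassV T X Y Z \oc tass T X Y Z = idm (X ** Y ** Z);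
  tassVK : forall X Y Z,
    tass T X Y Z \oc tassV T X Y Z = idm (X ** (Y ** Z));
  tlunit_iso : forall X, is_iso (tlunit T X);
  trunit_iso : forall X, is_iso (trunit T X);
  tbraidK : forall X Y, tbraid T Y X \oc tbraid T X Y = idm (X ** Y);
  tpentagon : forall X Y Z W,
    tass T X Y (Z ** W) \oc tass T (X ** Y) Z W =
    (idm X *** tass T Y Z W) \oc tass T X (Y ** Z) W
      \oc (tass T X Y Z *** idm W);
  ttriangle : forall X Y,
    (idm X *** tlunit T Y) \oc tass T X one Y = trunit T X *** idm Y;
  thexagon : forall X Y Z,
    tass T Y Z X \oc tbraid T X (Y ** Z) \oc tass T X Y Z =
    (idm Y *** tbraid T X Z) \oc tass T Y X Z \oc (tbraid T X Y *** idm Z) }.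

(* Y is a dual of X, with evaluation ev and coevaluation cv; the two triangle
   identities are composed with the unit constraints. *)
Definition is_dual X Y (ev : hom (Y ** X) one) (cv : hom one (X ** Y)) :
  Prop :=
  trunit T X \oc (idm X *** ev) \oc tass T X Y X \oc (cv *** idm X)
    = tlunit T X /\
  tlunit T Y \oc (ev *** idm Y) \oc tassV T Y X Y \oc (idm Y *** cv)
    = trunit T Y.

Definition is_rigid : Prop :=
  forall X, exists Y (ev : hom (Y ** X) one) (cv : hom one (X ** Y)),
    is_dual ev cv.
End TensorAxioms.
End Categories.

Arguments TensorData {F C}.

Record functor (F : fieldType) (C D : lincat F) := Functor {
  fob :> C -> D;
  fmor : forall X Y : C, hom X Y -> hom (fob X) (fob Y);
  fmor1 : forall X, fmor (idm X) = idm (fob X);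
  fmorM : forall X Y Z (g : hom Y Z) (f : hom X Y),
    fmor (g \oc f) = fmor g \oc fmor f }.

Arguments fmor {F C D} V {X Y} f : rename.

Section Functors.
Variables (F : fieldType) (C D : lincat F).
Variables (T : tensor_data C) (S : tensor_data D).

Definition is_linear_functor (V : functor C D) : Prop :=
  forall X Y, linear (fun f : hom X Y => fmor V f).

Definition is_faithful (V : functor C D) : Prop :=
  forall X Y, injective (fun f : hom X Y => fmor V f).

Definition is_exact (V : functor C D) : Prop :=
  forall X Y Z (f : hom X Y) (g : hom Y Z),
    short_exact f g -> short_exact (fmor V f) (fmor V g).

Record tensor_functor := TensorFunctor {
  tfun :> functor C D;
  tf_mu : forall X Y, hom (tob S (tfun X) (tfun Y)) (tfun (tob T X Y));
  tf_eps : hom (tone S) (tfun (tone T)) }.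

Record is_tensor_functor (V : tensor_functor) : Prop := IsTensorFunctor {
  tf_mu_iso : forall X Y, is_iso (tf_mu V X Y);
  tf_eps_iso : is_iso (tf_eps V);
  tf_mu_natural : forall X X' Y Y' (f : hom X X') (g : hom Y Y'),
    tf_mu V X' Y' \oc tmor S (fmor V f) (fmor V g) =
    fmor V (tmor T f g) \oc tf_mu V X Y;
  tf_ass : forall X Y Z,
    fmor V (tass T X Y Z) \oc tf_mu V (tob T X Y) Z
      \oc tmor S (tf_mu V X Y) (idm (V Z)) =
    tf_mu V X (tob T Y Z) \oc tmor S (idm (V X)) (tf_mu V Y Z)
      \oc tass S (V X) (V Y) (V Z);
  tf_braid : forall X Y,
    fmor V (tbraid T X Y) \oc tf_mu V X Y =
    tf_mu V Y X \oc tbraid S (V X) (V Y);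
  tf_lunit : forall X,
    fmor V (tlunit T X) \oc tf_mu V (tone T) X
      \oc tmor S (tf_eps V) (idm (V X)) = tlunit S (V X);
  tf_runit : forall X,
    fmor V (trunit T X) \oc tf_mu V X (tone T)
      \oc tmor S (idm (V X)) (tf_eps V) = trunit S (V X) }.
End Functors.

Section FullSubcategory.
Variables (F : fieldType) (C : lincat F) (P : C -> Prop).

Definition full_sub : lincat F :=
  @LinCat F {X : C | P X} (fun X Y => hom (sval X) (sval Y))
    (fun X => idm (sval X)) (fun X Y Z g f => g \oc f)
    (fun X Y f => ccomp1m f) (fun X Y f => ccompm1 f)
    (fun X Y Z T h g f => ccompA h g f)
    (fun X Y Z f => ccomp_linearl f) (fun X Y Z g => ccomp_linearr g).

Variable T : tensor_data C.
Hypothesis P1 : P (tone T).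
Hypothesis PM : forall X Y, P X -> P Y -> P (tob T X Y).

Definition full_sub_tensor : tensor_data full_sub :=
  @TensorData F full_sub
    (fun X Y => exist P (tob T (sval X) (sval Y)) (PM (svalP X) (svalP Y)))
    (fun X X' Y Y' f g => tmor T f g) (exist P (tone T) P1)
    (fun X Y Z => tass T (sval X) (sval Y) (sval Z))
    (fun X Y Z => tassV T (sval X) (sval Y) (sval Z))
    (fun X Y => tbraid T (sval X) (sval Y))
    (fun X => tlunit T (sval X)) (fun X => trunit T (sval X)).
End FullSubcategory.

Section RestrictFunctor.
Variables (F : fieldType) (C D : lincat F) (P : C -> Prop) (Q : D -> Prop).
Variables (T : tensor_data C) (S : tensor_data D) (V : tensor_functor T S).
Hypothesis PQ : forall X, P X -> Q (V X).
Hypothesis P1 : P (tone T).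
Hypothesis PM : forall X Y, P X -> P Y -> P (tob T X Y).
Hypothesis Q1 : Q (tone S).
Hypothesis QM : forall X Y, Q X -> Q Y -> Q (tob S X Y).

Definition restrict_functor : functor (full_sub P) (full_sub Q) :=
  @Functor F (full_sub P) (full_sub Q)
    (fun X => exist Q (V (sval X)) (PQ (svalP X)))
    (fun X Y f => fmor V f) (fun X => fmor1 V (sval X))
    (fun X Y Z g f => fmorM V g f).

Definition restrict_tensor_functor :
  tensor_functor (full_sub_tensor P1 PM) (full_sub_tensor Q1 QM) :=
  @TensorFunctor F (full_sub P) (full_sub Q)
    (full_sub_tensor P1 PM) (full_sub_tensor Q1 QM) restrict_functor
    (fun X Y => tf_mu V (sval X) (sval Y)) (tf_eps V).
End RestrictFunctor.

Section LinearMaps.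
Variables (K : fieldType) (M N : lmodType K).

Definition lin_pred : {pred M -> N} := fun f => `[< linear f >].

Fact lin_pred_submod : submod_closed lin_pred.
Proof.
split=> [|a f g /asboolP fl /asboolP gl]; apply/asboolP=> b x y.
  by rewrite scaler0 addr0.
have E z : (a *: f + g) z = a *: f z + g z by [].
by rewrite !E fl gl !scalerDr !scalerA mulrC addrACA.
Qed.
HB.instance Definition _ :=
  GRing.isSubmodClosed.Build K (M -> N) lin_pred lin_pred_submod.

Definition lin_map : lmodType K := submod lin_pred.

Definition lin_of (f : M -> N) (fl : semilinear_for id f) : lin_map :=
  @Submod K (M -> N) lin_pred f (asboolT (proj1 (semilinear_forP f) fl)).

Lemma lin_mapP (f : lin_map) : semilinear_for id (val f).
Proof. by apply/semilinear_forP; case: f => f /= /asboolP. Qed.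
End LinearMaps.

Lemma semi_id (K : nzRingType) (M : lmodType K) : semilinear_for id (@id M).
Proof. by []. Qed.

Lemma semi_comp (K : nzRingType) (M N P : lmodType K) (g : N -> P) (f : M -> N) :
  semilinear_for id g -> semilinear_for id f -> semilinear_for id (g \o f).
Proof.
by case=> gD gZ [fD fZ]; split=> [x y|a x] /=; rewrite ?fD ?gD ?fZ ?gZ.
Qed.

Section ModCategory.
Variable K : fieldType.
Implicit Types M N P : lmodType K.

Definition lin_comp M N P (g : lin_map N P) (f : lin_map M N) : lin_map M P :=
  lin_of (semi_comp (lin_mapP g) (lin_mapP f)).

Fact lin_comp_linearl M N P (f : lin_map M N) :
  linear (fun g : lin_map N P => lin_comp g f).
Proof. by move=> a g h; apply: val_inj. Qed.

Fact lin_comp_linearr M N P (g : lin_map N P) :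
  linear (fun f : lin_map M N => lin_comp g f).
Proof.
move=> a f h; apply: val_inj; apply/funext=> x.
exact: (proj1 (semilinear_forP _) (lin_mapP g)).
Qed.

Definition mod_cat : lincat K.
Proof.
refine (@LinCat K (lmodType K) (@lin_map K) (fun M => lin_of (semi_id M)) lin_comp
  _ _ _ lin_comp_linearl lin_comp_linearr); by move=> *; apply: val_inj.
Defined.

Definition mod_tensor : tensor_data mod_cat :=
  @TensorData K mod_cat (fun M N => tens M N)
    (fun M M' N N' f g => lin_of (tens_map_semi (lin_mapP f) (lin_mapP g)))
    (K^o : lmodType K)
    (fun M N P => lin_of (tens_assoc_semi M N P))
    (fun M N P => lin_of (tens_assocV_semi M N P))
    (fun M N => lin_of (tens_swap_semi M N))
    (fun M => lin_of (tens_lunit_semi M))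
    (fun M => lin_of (tens_runit_semi M)).

Definition fin_dim (M : lmodType K) : Prop :=
  exists n, inhabited (Vector.axiom n M).

Lemma fin_dim_one : fin_dim K^o.
Proof.
exists 1; constructor; exists (fun a : K^o => const_mx (a : K)).
  by move=> a x y; apply/rowP=> i; rewrite !mxE.
exists (fun v : 'rV[K]_1 => v 0 0 : K^o) => [x|v]; first by rewrite mxE.
by apply/rowP=> i; rewrite mxE ord1.
Qed.

Lemma tpure_suml M N (I : finType) (x : I -> M) (y : N) :
  tpure (\sum_i x i) y = \sum_i tpure (x i) y.
Proof.
apply: (big_morph (fun x => tpure x y)); first exact: tpureDl.
exact: balanced0 (balanced_tpure M N).
Qed.

Lemma tpure_sumr M N (I : finType) (x : M) (y : I -> N) :
  tpure x (\sum_i y i) = \sum_i tpure x (y i).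
Proof.
apply: (big_morph (tpure x)); first exact: tpureDr.
by rewrite -(scale0r 0) tpureZr scale0r.
Qed.

Lemma fin_dim_tens M N : fin_dim M -> fin_dim N -> fin_dim (tens M N).
Proof.
case=> m [[f fl [f' fK f'K]]] [n [[g gl [g' gK g'K]]]].
have [fD fZ] := proj2 (semilinear_forP f) fl.
have [gD gZ] := proj2 (semilinear_forP g) gl.
pose b x y := mxvec ((f x)^T *m g y).
have bb : balanced b.
  split=> [y x x'|x y y'|a x y]; rewrite /b.
  - by rewrite fD linearD mulmxDl linearD.
  - by rewrite gD mulmxDr linearD.
  - by rewrite fZ gZ linearZ -scalemxAl -scalemxAr.
have bZ a x y : b (a *: x) y = a *: b x y.
  by rewrite /b fZ linearZ /= -scalemxAl linearZ.
pose k (v : 'rV[K]_(m * n)) := \sum_i \sum_j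
  (vec_mx v) i j *: tpure (f' (delta_mx 0 i)) (g' (delta_mx 0 j)).
have kD : {morph k : u v / u + v}.
  move=> u v; rewrite /k -big_split; apply: eq_bigr => i _ /=.
  rewrite -big_split; apply: eq_bigr => j _ /=.
  by rewrite linearD mxE scalerDl.
have [hD hZ] := tens_lift_semi bb bZ.
exists (m * n)%N; constructor; exists (tens_lift b).
  exact: (proj1 (semilinear_forP _) (tens_lift_semi bb bZ)).
exists k => [|v].
  apply: tens_ext => [s t|//|x y]; first by rewrite hD kD.
  rewrite tens_lift_tpure // /k /b mxvecK.
  have f'D : {morph f' : u v / u + v}.
    by move=> u v; apply: (can_inj fK); rewrite fD !f'K.
  have f'Z a u : f' (a *: u) = a *: f' u.
    by apply: (can_inj fK); rewrite fZ !f'K.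
  have g'D : {morph g' : u v / u + v}.
    by move=> u v; apply: (can_inj gK); rewrite gD !g'K.
  have g'Z a u : g' (a *: u) = a *: g' u.
    by apply: (can_inj gK); rewrite gZ !g'K.
  have f'0 : f' 0 = 0 by rewrite -(scale0r 0) f'Z scale0r.
  have g'0 : g' 0 = 0 by rewrite -(scale0r 0) g'Z scale0r.
  rewrite -[in RHS](fK x) -[in RHS](gK y).
  rewrite [in RHS](row_sum_delta (f x)) [in RHS](row_sum_delta (g y)).
  rewrite (big_morph f' f'D f'0) (big_morph g' g'D g'0) tpure_suml.
  apply: eq_bigr => i _; rewrite tpure_sumr; apply: eq_bigr => j _.
  rewrite f'Z g'Z tpureZl tpureZr scalerA; congr (_ *: _).
  by rewrite mxE big_ord1 mxE.
have h0 : tens_lift b 0 = 0 by rewrite -(scale0r 0) hZ scale0r.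
rewrite /k (big_morph _ hD h0) -[RHS]vec_mxK.
rewrite [in RHS](matrix_sum_delta (vec_mx v)) linear_sum.
apply: eq_bigr => i _ /=; rewrite (big_morph _ hD h0) linear_sum.
apply: eq_bigr => j _ /=; rewrite hZ linearZ /= tens_lift_tpure //.
by rewrite /b f'K g'K trmx_delta mul_delta_mx.
Qed.

Definition vec_cat : lincat K := full_sub (fun M : mod_cat => fin_dim M).
Definition vec_tensor : tensor_data vec_cat :=
  @full_sub_tensor K mod_cat fin_dim mod_tensor fin_dim_one fin_dim_tens.
End ModCategory.

Section Tannakian.
Variables (F : fieldType) (C : lincat F) (T : tensor_data C).

Definition is_fiber_functor (V : tensor_functor T (vec_tensor F)) : Prop :=
  [/\ is_exact V, is_faithful V, is_linear_functor V & is_tensor_functor V].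

Definition is_neutral_tannakian : Prop :=
  [/\ is_tensor_category T, is_rigid T, is_abelian C,
      bijective (fun a : F => a *: idm (tone T))
    & exists V : tensor_functor T (vec_tensor F), is_fiber_functor V].
End Tannakian.

Section TensorAlgebra.
Variables (K : comNzRingType) (A B : comAlgType K).

Definition tens_mul (s t : tens A B) : tens A B :=
  tens_lift (fun a b => tens_map ( *%R a) ( *%R b) t) s.

Lemma mulr_semi (C : comAlgType K) (c : C) : semilinear_for id ( *%R c).
Proof. by split=> [x y|a x]; rewrite ?mulrDr ?scalerAr. Qed.

Lemma tens_mul_bal (t : tens A B) :
  balanced (fun a b => tens_map ( *%R a) ( *%R b) t).
Proof.
have D a b := tens_mapD (mulr_semi a) (mulr_semi b).
have P a b x y := tens_map_tpure (mulr_semi a) (mulr_semi b) x y.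
split=> [b a a'|a b b'|k a b]; move: t; apply: tens_ext => [s t|s t|x y];
  rewrite ?D //; try by rewrite addrACA.
- by rewrite !P mulrDl tpureDl.
- by rewrite !P mulrDl tpureDr.
- by rewrite !P -!scalerAl tpureZl tpureZr.
Qed.

Lemma tens_mul_tpure a b a' b' :
  tens_mul (tpure a b) (tpure a' b') = tpure (a * a') (b * b').
Proof.
rewrite /tens_mul tens_lift_tpure; last exact: tens_mul_bal.
exact: (tens_map_tpure (mulr_semi a) (mulr_semi b)).
Qed.
End TensorAlgebra.

(* Separability of an algebra over a field, in the sense of Bourbaki: it stays
   reduced after every field extension; iter n (tens_mul t) t is t ^ n.+1. *)
Definition separable_alg (E : fieldType) (L : comAlgType E) : Prop :=
  forall K : comAlgType E,
    (forall x : K, x != 0 -> exists y, x * y = 1) ->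
  forall (t : tens K L) (n : nat), iter n (tens_mul t) t = 0 -> t = 0.

(* The inclusions F < E < L are the morphism st_inc and the structural map
   a |-> a%:A; st_sigmaE is the restriction of st_sigma to E. The factors st_Ll
   are indexed by 'I_st_d, with cyclic successor ordS, and the subset L_l of L
   consists of the elements whose other coordinates vanish. *)
Record sigma_triple := SigmaTriple {
  st_d : nat;
  st_d_gt0 : (0 < st_d)%N;
  st_F : fieldType;
  st_E : fieldType;
  st_L : comAlgType st_E;
  st_inc : {rmorphism st_F -> st_E};
  st_Ll : 'I_st_d -> fieldType;
  st_pr : forall l, {rmorphism st_L -> st_Ll l};
  st_prodP : forall x : (forall l, st_Ll l),
    exists! y : st_L, forall l, st_pr l y = x l;
  st_sigma : {rmorphism st_L -> st_L};
  st_sigmaE : {rmorphism st_E -> st_E};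
  st_sigma_alg : forall a : st_E, st_sigma a%:A = (st_sigmaE a)%:A;
  st_sigma_cyclic : forall (l : 'I_st_d) (x : st_L),
    (forall k, k != l -> st_pr k x = 0) ->
    forall k, k != ordS l -> st_pr k (st_sigma x) = 0;
  st_fixE : forall a : st_E, st_sigmaE a = a <-> exists c, a = st_inc c;
  st_fixL : forall x : st_L, st_sigma x = x <-> exists c, x = (st_inc c)%:A;
  st_separable : separable_alg st_L }.

Section PhiModules.
Variable T : sigma_triple.

Local Notation F := (st_F T).
Local Notation E := (st_E T).
Local Notation L := (st_L T).
Local Notation sigma := (st_sigma T).
Local Notation sigmaE := (st_sigmaE T).
Local Notation inc := (st_inc T).

Record phimod := Phimod {
  pm_mod :> lmodType E;
  pm_phi : pm_mod -> pm_mod;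
  pm_phiP : semilinear_for sigmaE pm_phi }.

Arguments pm_phi : clear implicits.

Section PhiHom.
Variables M N : phimod.

(* Morphisms of phi-modules, inside the F-module of functions M -> N. *)
Definition phi_pred : {pred M -> restr inc N} := fun f =>
  `[< linear (f : M -> N) /\ forall x, f (pm_phi M x) = pm_phi N (f x) >].

Fact phi_pred_submod : submod_closed phi_pred.
Proof.
have [phiD phiZ] := pm_phiP N.
split=> [|a f g /asboolP[fl fphi] /asboolP[gl gphi]]; apply/asboolP.
  split=> [b x y|x]; first by rewrite /= scaler0 addr0.
  by apply: (addIr (pm_phi N 0)); rewrite -phiD !add0r.
have E z : (a *: f + g) z = inc a *: (f z : N) + g z :> N by [].
split=> [b x y|x].
  by rewrite !E fl gl !scalerDr !scalerA mulrC addrACA.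
have inca : sigmaE (inc a) = inc a by apply/st_fixE; exists a.
by rewrite !E phiD phiZ fphi gphi inca.
Qed.
HB.instance Definition _ := GRing.isSubmodClosed.Build F (M -> restr inc N)
  phi_pred phi_pred_submod.

Definition phi_hom : lmodType F := submod phi_pred.

Definition phi_fun (f : phi_hom) : M -> N := val f.

Lemma phi_homP (f : phi_hom) : semilinear_for id (phi_fun f) /\
  forall x, phi_fun f (pm_phi M x) = pm_phi N (phi_fun f x).
Proof. by rewrite /phi_fun; case: f => f /= /asboolP[/semilinear_forP]. Qed.

Definition phi_of (f : M -> N) (fl : semilinear_for id f)
    (fphi : forall x, f (pm_phi M x) = pm_phi N (f x)) : phi_hom :=
  @Submod F (M -> restr inc N) phi_pred f
    (asboolT (conj (proj1 (semilinear_forP f) fl) fphi)).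
End PhiHom.

Definition phi_id (M : phimod) : phi_hom M M :=
  phi_of (semi_id M) (fun x => erefl).

Fact phi_comp_phi (M N P : phimod) (g : phi_hom N P) (f : phi_hom M N) x :
  (phi_fun g \o phi_fun f) (pm_phi M x) = pm_phi P ((phi_fun g \o phi_fun f) x).
Proof. by rewrite /= (proj2 (phi_homP f)) (proj2 (phi_homP g)). Qed.

Definition phi_comp (M N P : phimod) (g : phi_hom N P) (f : phi_hom M N) :
    phi_hom M P :=
  phi_of (semi_comp (proj1 (phi_homP g)) (proj1 (phi_homP f)))
    (phi_comp_phi g f).

Fact phi_comp_linearl (M N P : phimod) (f : phi_hom M N) :
  linear (fun g : phi_hom N P => phi_comp g f).
Proof. by move=> a g h; apply: val_inj. Qed.

Fact phi_comp_linearr (M N P : phimod) (g : phi_hom N P) :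
  linear (fun f : phi_hom M N => phi_comp g f).
Proof.
move=> a f h; apply: val_inj; apply/funext=> x.
have [gD gZ] := proj1 (phi_homP g).
have E : phi_fun g (inc a *: phi_fun f x + phi_fun h x) =
  inc a *: phi_fun g (phi_fun f x) + phi_fun g (phi_fun h x) by rewrite gD gZ.
exact: E.
Qed.

Definition phi_cat : lincat F.
Proof.
refine (@LinCat F phimod phi_hom phi_id phi_comp
  _ _ _ phi_comp_linearl phi_comp_linearr); by move=> *; apply: val_inj.
Defined.

Definition phi_one : phimod.
Proof.
refine (@Phimod E^o sigmaE _).
by split=> [x y|a x]; rewrite ?rmorphD ?rmorphM.
Defined.

Definition phi_tens (M N : phimod) : phimod :=
  Phimod (tens_map_semi (pm_phiP M) (pm_phiP N)).

Lemma phi_tens_tpure (M N : phimod) (x : M) (y : N) :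
  pm_phi (phi_tens M N) (tpure x y) = tpure (pm_phi M x) (pm_phi N y).
Proof. exact: tens_map_tpure (pm_phiP M) (pm_phiP N) x y. Qed.

Lemma phi_tensD (M N : phimod) :
  {morph pm_phi (phi_tens M N) : s t / s + t}.
Proof. exact: (proj1 (pm_phiP (phi_tens M N))). Qed.

Section PhiTensorMap.
Variables (M M' N N' : phimod) (f : phi_hom M M') (g : phi_hom N N').

Fact phi_tmor_phi s :
  tens_map (phi_fun f) (phi_fun g) (pm_phi (phi_tens M N) s) =
  pm_phi (phi_tens M' N') (tens_map (phi_fun f) (phi_fun g) s).
Proof.
have [[fs fphi] [gs gphi]] := (phi_homP f, phi_homP g).
have fgD := tens_mapD fs gs.
move: s; apply: tens_ext => [s t|s t|x y].
- by rewrite phi_tensD fgD.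
- by rewrite fgD phi_tensD.
- by rewrite phi_tens_tpure !(tens_map_tpure fs gs) phi_tens_tpure fphi gphi.
Qed.

Definition phi_tmor : phi_hom (phi_tens M N) (phi_tens M' N') :=
  phi_of (M := phi_tens M N) (N := phi_tens M' N')
    (tens_map_semi (proj1 (phi_homP f)) (proj1 (phi_homP g))) phi_tmor_phi.
End PhiTensorMap.

Section PhiConstraints.
Variables M N P : phimod.

Fact phi_assoc_phi s :
  tens_assoc (pm_phi (phi_tens (phi_tens M N) P) s) =
  pm_phi (phi_tens M (phi_tens N P)) (tens_assoc s).
Proof.
have aD := proj1 (tens_assoc_semi M N P).
move: s; apply: tens_ext3l => [s t|s t|x y z].
- by rewrite phi_tensD aD.
- by rewrite aD phi_tensD.
- by rewrite !(phi_tens_tpure, tens_assoc_tpure).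
Qed.

Fact phi_assocV_phi s :
  tens_assocV (pm_phi (phi_tens M (phi_tens N P)) s) =
  pm_phi (phi_tens (phi_tens M N) P) (tens_assocV s).
Proof.
have aD := proj1 (tens_assocV_semi M N P).
move: s; apply: tens_ext3r => [s t|s t|x y z].
- by rewrite phi_tensD aD.
- by rewrite aD phi_tensD.
- by rewrite !(phi_tens_tpure, tens_assocV_tpure).
Qed.

Fact phi_swap_phi s :
  tens_swap (pm_phi (phi_tens M N) s) = pm_phi (phi_tens N M) (tens_swap s).
Proof.
have aD := proj1 (tens_swap_semi M N).
move: s; apply: tens_ext => [s t|s t|x y].
- by rewrite phi_tensD aD.
- by rewrite aD phi_tensD.
- by rewrite !(phi_tens_tpure, tens_swap_tpure).
Qed.

Fact phi_lunit_phi s :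
  tens_lunit (pm_phi (phi_tens phi_one M) s) = pm_phi M (tens_lunit s).
Proof.
have aD := proj1 (tens_lunit_semi M).
have [pD pZ] := pm_phiP M.
move: s; apply: tens_ext => [s t|s t|a x].
- by rewrite phi_tensD aD.
- by rewrite aD pD.
- by rewrite phi_tens_tpure !tens_lunit_tpure pZ.
Qed.

Fact phi_runit_phi s :
  tens_runit (pm_phi (phi_tens M phi_one) s) = pm_phi M (tens_runit s).
Proof.
have aD := proj1 (tens_runit_semi M).
have [pD pZ] := pm_phiP M.
move: s; apply: tens_ext => [s t|s t|x a].
- by rewrite phi_tensD aD.
- by rewrite aD pD.
- by rewrite phi_tens_tpure !tens_runit_tpure pZ.
Qed.
End PhiConstraints.

Definition phi_tensor : tensor_data phi_cat :=
  @TensorData F phi_cat phi_tens phi_tmor phi_one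
    (fun M N P => phi_of (M := phi_tens (phi_tens M N) P)
       (N := phi_tens M (phi_tens N P))
       (tens_assoc_semi M N P) (@phi_assoc_phi M N P))
    (fun M N P => phi_of (M := phi_tens M (phi_tens N P))
       (N := phi_tens (phi_tens M N) P)
       (tens_assocV_semi M N P) (@phi_assocV_phi M N P))
    (fun M N => phi_of (M := phi_tens M N) (N := phi_tens N M)
       (tens_swap_semi M N) (@phi_swap_phi M N))
    (fun M => phi_of (M := phi_tens phi_one M) (tens_lunit_semi M)
       (@phi_lunit_phi M))
    (fun M => phi_of (M := phi_tens M phi_one) (tens_runit_semi M)
       (@phi_runit_phi M)).

Lemma sigma_semi : semilinear_for sigmaE (sigma : L -> L).
Proof.
split=> [x y|a x]; first by rewrite rmorphD.
by rewrite -mulr_algl rmorphM st_sigma_alg mulr_algl.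
Qed.

Definition phiL (M : phimod) : tens L M -> tens L M :=
  tens_map sigma (pm_phi M).
Arguments phiL : clear implicits.

Lemma phiL_semi M : semilinear_for sigmaE (phiL M).
Proof. exact: tens_map_semi sigma_semi (pm_phiP M). Qed.

Lemma phiL_tpure M l x : phiL M (tpure l x) = tpure (sigma l) (pm_phi M x).
Proof. exact: tens_map_tpure sigma_semi (pm_phiP M) l x. Qed.

Section FixedPoints.
Variable M : phimod.

Definition fix_pred : {pred restr inc (tens L M)} := fun t => phiL M t == t.

Fact fix_pred_submod : submod_closed fix_pred.
Proof.
have [pD pZ] := phiL_semi M; split=> [|a u v /eqP ut /eqP vt]; apply/eqP.
  by apply: (addIr (phiL M 0)); rewrite -pD !add0r.
have inca : sigmaE (inc a) = inc a by apply/st_fixE; exists a.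
by rewrite pD pZ ut vt inca.
Qed.
HB.instance Definition _ := GRing.isSubmodClosed.Build F
  (restr inc (tens L M)) fix_pred fix_pred_submod.

Definition Vmod : lmodType F := submod fix_pred.

Definition Vval (v : Vmod) : tens L M := val v.

Lemma VvalP (v : Vmod) : phiL M (Vval v) = Vval v.
Proof. by rewrite /Vval; case: v => v /= /eqP. Qed.

Lemma Vval_inj : injective Vval.
Proof. exact: val_inj. Qed.

Lemma VvalD : {morph Vval : v w / v + w}.
Proof. by []. Qed.

Lemma VvalZ a v : Vval (a *: v) = inc a *: Vval v.
Proof. by []. Qed.

Definition V_of (t : tens L M) (ht : phiL M t = t) : Vmod :=
  @Submod F (restr inc (tens L M)) fix_pred t (introT eqP ht).

(* V(M) is Vmod M, as an F-module. The natural map L (x)_F V(M) -> L (x)_E M sending l (x) v to l v. *)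
Definition natural_map : tens (restr inc L) Vmod -> tens L M :=
  @tens_lift F (restr inc L) Vmod (tens L M) (fun l v =>
    tens_map ( *%R (l : L)) (@id M) (Vval v)).

Fact natural_map_bal : @balanced F (restr inc L) Vmod (tens L M) (fun l v =>
  tens_map ( *%R (l : L)) (@id M) (Vval v)).
Proof.
have S (l : L) := tens_map_semi (mulr_semi l) (semi_id M).
have P (l : L) := tens_map_tpure (mulr_semi l) (semi_id M).
split=> [v l l'|l v w|a l v].
- move: (Vval v); apply: tens_ext => [s t|s t|l1 x].
  + exact: (proj1 (S (l + l' : L))).
  + by rewrite !(proj1 (S _)) addrACA.
  + by rewrite !P mulrDl tpureDl.
- by rewrite VvalD (proj1 (S l)).
- rewrite VvalZ (proj2 (S l)); move: (Vval v).
  apply: tens_ext => [s t|s t|l1 x].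
  + exact: (proj1 (S (inc a *: (l : L)))).
  + by rewrite (proj1 (S l)) scalerDr.
  + by rewrite (P l) (P (inc a *: (l : L))) -scalerAl tpureZl.
Qed.

Lemma natural_map_tpure (l : L) (v : Vmod) :
  natural_map (tpure (l : restr inc L) v) =
  tens_map ( *%R l) (@id M) (Vval v).
Proof. exact: tens_lift_tpure natural_map_bal. Qed.

Definition L_trivial : Prop := fin_dim M /\ bijective natural_map.
End FixedPoints.

Section VMorphism.
Variables (M N : phimod) (f : phi_hom M N).

Fact V_fmor_fix (v : Vmod M) :
  phiL N (tens_map (@id L) (phi_fun f) (Vval v)) =
  tens_map (@id L) (phi_fun f) (Vval v).
Proof.
have [fs fphi] := phi_homP f; have [idfD _] := tens_map_semi (semi_id L) fs.
rewrite -[in RHS]VvalP; move: (Vval v).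
have [pM pN] := (proj1 (phiL_semi M), proj1 (phiL_semi N)).
apply: tens_ext => [s t|s t|l x].
- by rewrite idfD pN.
- by rewrite pM idfD.
- by rewrite !(phiL_tpure, tens_map_tpure (semi_id L) fs) fphi.
Qed.

Definition V_fun (v : Vmod M) : Vmod N := V_of (V_fmor_fix v).

Lemma Vval_fun v : Vval (V_fun v) = tens_map (@id L) (phi_fun f) (Vval v).
Proof. by []. Qed.

Fact V_fun_semi : semilinear_for id V_fun.
Proof.
have [D Z] := tens_map_semi (semi_id L) (proj1 (phi_homP f)).
by split=> [v w|a v]; apply: Vval_inj;
  rewrite ?VvalD ?VvalZ !Vval_fun ?VvalD ?VvalZ ?D ?Z.
Qed.
End VMorphism.

Fact V_fun1 M v : V_fun (phi_id M) v = v.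
Proof.
apply: Vval_inj; rewrite Vval_fun; move: (Vval v).
have [D _] := tens_map_semi (semi_id L) (proj1 (phi_homP (phi_id M))).
apply: tens_ext => // l x.
exact: (tens_map_tpure (semi_id L) (proj1 (phi_homP (phi_id M)))).
Qed.

Fact V_funM M N P (g : phi_hom N P) (f : phi_hom M N) v :
  V_fun (phi_comp g f) v = V_fun g (V_fun f v).
Proof.
apply: Vval_inj; rewrite !Vval_fun; move: (Vval v).
have [fs gs] := (proj1 (phi_homP f), proj1 (phi_homP g)).
have gfs := proj1 (phi_homP (phi_comp g f)).
have [D1 _] := tens_map_semi (semi_id L) fs.
have [D2 _] := tens_map_semi (semi_id L) gs.
have [D3 _] := tens_map_semi (semi_id L) gfs.
apply: tens_ext => [s t|s t|l x]; first exact: D3.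
  by rewrite D1 D2.
by rewrite (tens_map_tpure (semi_id L) fs) (tens_map_tpure (semi_id L) gs)
  (tens_map_tpure (semi_id L) gfs).
Qed.

Definition V_functor : functor phi_cat (mod_cat F).
Proof.
refine (@Functor F phi_cat (mod_cat F) Vmod
  (fun M N f => lin_of (V_fun_semi f)) _ _) => [M|M N P g f];
  apply: val_inj; apply/funext=> v; [exact: V_fun1 | exact: V_funM].
Defined.

(* The pairing of L (x) M and L (x) N into L (x) (M (x) N), sending l (x) x and
   l' (x) y to l l' (x) (x (x) y). *)
Section VTensor.
Variables M N : phimod.

Definition V_pair (s : tens L M) (t : tens L N) : tens L (tens M N) :=
  tens_lift (fun l x => tens_map ( *%R l) (@tpure _ M N x) t) s.

Fact tpure_semi (x : M) : semilinear_for id (@tpure _ M N x).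
Proof. by split=> [y y'|a y]; rewrite ?tpureDr ?tpureZr. Qed.

Fact V_pair_bal t :
  balanced (fun (l : L) (x : M) => tens_map ( *%R l) (@tpure _ M N x) t).
Proof.
have D l x := tens_mapD (mulr_semi l) (tpure_semi x).
have P l x l' y := tens_map_tpure (mulr_semi l) (tpure_semi x) l' y.
split=> [x l l'|l x x'|a l x]; move: t; apply: tens_ext => [s t|s t|l1 y];
  rewrite ?D //; try by rewrite addrACA.
- by rewrite !P mulrDl tpureDl.
- by rewrite !P tpureDl tpureDr.
- by rewrite !P -scalerAl !tpureZl tpureZr.
Qed.

Lemma V_pair_tpure l x l' y :
  V_pair (tpure l x) (tpure l' y) = tpure (l * l') (tpure x y).
Proof.
rewrite /V_pair tens_lift_tpure; last exact: V_pair_bal.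
exact: (tens_map_tpure (mulr_semi l) (tpure_semi x)).
Qed.

Lemma V_pairl_semi t : semilinear_for id (V_pair^~ t).
Proof.
apply: tens_lift_semi; first exact: V_pair_bal.
move=> a l x; move: t.
have D l1 x1 := tens_mapD (mulr_semi l1) (tpure_semi x1).
have P l1 x1 l' y := tens_map_tpure (mulr_semi l1) (tpure_semi x1) l' y.
apply: tens_ext => [s t|s t|l1 y]; rewrite ?D ?scalerDr //.
by rewrite !P -scalerAl tpureZl.
Qed.

Lemma V_pairr_semi s : semilinear_for id (V_pair s).
Proof.
split=> [t t'|a t].
  apply: tens_liftDf => l x.
  exact: (tens_mapD (mulr_semi l) (tpure_semi x)).
apply: tens_liftZf => l x.
exact: (proj2 (tens_map_semi (mulr_semi l) (tpure_semi x))).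
Qed.

Lemma phiL_V_pair s t :
  phiL (phi_tens M N) (V_pair s t) = V_pair (phiL M s) (phiL N t).
Proof.
have pT := proj1 (phiL_semi (phi_tens M N)).
have [pM pN] := (proj1 (phiL_semi M), proj1 (phiL_semi N)).
have lD u := proj1 (V_pairl_semi u); have rD u := proj1 (V_pairr_semi u).
move: s; apply: tens_ext => [s s'|s s'|l x].
- by rewrite lD pT.
- by rewrite pM lD.
move: t; apply: tens_ext => [t t'|t t'|l' y].
- by rewrite rD pT.
- by rewrite pN rD.
by rewrite !(phiL_tpure, V_pair_tpure) phi_tens_tpure rmorphM.
Qed.

Fact V_mul_fix (v : Vmod M) (w : Vmod N) :
  phiL (phi_tens M N) (V_pair (Vval v) (Vval w)) = V_pair (Vval v) (Vval w).
Proof. by rewrite phiL_V_pair !VvalP. Qed.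

Definition V_mul (v : Vmod M) (w : Vmod N) : Vmod (phi_tens M N) :=
  V_of (V_mul_fix v w).

Lemma Vval_mul v w : Vval (V_mul v w) = V_pair (Vval v) (Vval w).
Proof. by []. Qed.

Fact V_mul_bal : balanced V_mul.
Proof.
split=> [w v v'|v w w'|a v w]; apply: Vval_inj.
- by rewrite VvalD !Vval_mul VvalD (proj1 (V_pairl_semi _)).
- by rewrite VvalD !Vval_mul VvalD (proj1 (V_pairr_semi _)).
- by rewrite !Vval_mul !VvalZ (proj2 (V_pairl_semi _)) (proj2 (V_pairr_semi _)).
Qed.

Fact V_mu_semi : semilinear_for id (tens_lift V_mul).
Proof.
apply: tens_lift_semi V_mul_bal _ => a v w; apply: Vval_inj.
by rewrite VvalZ !Vval_mul VvalZ (proj2 (V_pairl_semi _)).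
Qed.
End VTensor.

Fact V_one_fix (c : F) :
  phiL phi_one (tpure 1 (inc c : E^o)) = tpure 1 (inc c : E^o).
Proof.
by rewrite phiL_tpure rmorph1; congr tpure; apply/st_fixE; exists c.
Qed.

Definition V_unit (c : F^o) : Vmod phi_one := V_of (V_one_fix c).

Fact V_unit_semi : semilinear_for id V_unit.
Proof.
have E c : Vval (V_unit c) = tpure 1 (inc c : E^o) by [].
split=> [x y|a x]; apply: Vval_inj; rewrite ?VvalD ?VvalZ !E.
  by rewrite rmorphD tpureDr.
by rewrite rmorphM -tpureZr.
Qed.

Definition V_tensor : tensor_functor phi_tensor (mod_tensor F) :=
  @TensorFunctor F phi_cat (mod_cat F) phi_tensor (mod_tensor F) V_functor
    (fun M N => lin_of (V_mu_semi M N)) (lin_of V_unit_semi).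

Definition trivial_cat : lincat F :=
  full_sub (fun M : phi_cat => L_trivial M).

Section TrivialTensor.
Hypothesis T1 : L_trivial phi_one.
Hypothesis TM : forall M N : phimod,
  L_trivial M -> L_trivial N -> L_trivial (phi_tens M N).
Hypothesis TV : forall M : phimod, L_trivial M -> fin_dim (Vmod M).

Definition trivial_tensor : tensor_data trivial_cat :=
  @full_sub_tensor F phi_cat L_trivial phi_tensor T1 TM.

Definition trivial_V : tensor_functor trivial_tensor (vec_tensor F) :=
  @restrict_tensor_functor F phi_cat (mod_cat F) L_trivial (@fin_dim F)
    phi_tensor (mod_tensor F) V_tensor TV T1 TM
    (fin_dim_one F) (@fin_dim_tens F).
End TrivialTensor.
End PhiModules.

(* Main.v *)
(* L has no proper nonzero sigma-stable ideal, since sigma permutes cyclically the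
   idempotents of its factors. Hence a fixed vector outside the F-span of an
   L-independent family of fixed vectors of L (x) M extends this family, and M is
   L-trivial exactly when L (x) M has an L-basis of fixed vectors. In coordinates,
   phi being v |-> v^sigma Phi, this is an invertible P with P^sigma Phi = P.
   A morphism A between L-trivial modules then becomes the sigma-fixed matrix
   G = P A R^-1, over F: kernels and cokernels of G over F provide bases of fixed
   vectors of the kernels and cokernels of A over E, so the category is abelian
   and V is exact. Duals are given by (Phi^T)^-1, P^-T, and tensor products by the
   products of the two bases. *)
From mathcomp Require Import all_boot all_algebra.
From mathcomp Require Import boolp functions.
Require Import Defs.

Set Implicit Arguments.
Unset Strict Implicit.
Unset Printing Implicit Defensive.

Import GRing.Theory.
Import Defs.
Local Open Scope ring_scope.

(** Apart from one dimension bound read in a single factor of [L], linear algebra is done over the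
    fields [E] and [F], and its results are recorded as identities such as [B *m A = 0],
    [B *m Z = 1%:M], [A *m A' + Z *m B = 1%:M]. These survive every ring morphism, hence can be
    conjugated by sigma or read over [L] without any flatness argument. Exactness of [V] rests on
    the same device: a short exact sequence is split [E]-linearly, and the splitting, which need not
    commute with phi, is tensored with [L]. The definition of a phi-module does not ask the matrix
    of phi to be invertible. This is deduced from triviality, and it is what makes duals exist. *)

Lemma inj_surj_bij (A B : Type) (f : A -> B) :
  injective f -> (forall y, exists x, f x = y) -> bijective f.
Proof. by move=> fI /choice[g gK]; exists g => // x; apply: fI; rewrite gK. Qed.

(** * Splitting a matrix over a field by its kernel and cokernel *)

Section MatrixSplitting.
Variable K : fieldType.

(** The rows of [B] are a basis of the kernel, and [Z] returns coordinates in it, since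
    [1 - A *m A'] projects onto the kernel when [A'] is a pseudo-inverse. Stating this by equations
    lets it be transported along ring morphisms. *)
Lemma mx_kernel m n (A : 'M[K]_(m, n)) :
  exists k (B : 'M_(k, m)) (Z : 'M_(m, k)) (A' : 'M_(n, m)),
  [/\ B *m A = 0, B *m Z = 1%:M & A *m A' + Z *m B = 1%:M].
Proof.
exists (\rank (kermx A)), (row_base (kermx A)).
have BA : row_base (kermx A) *m A = 0 by apply/sub_kermxP; rewrite eq_row_base.
have : (1%:M - A *m pinvmx A <= row_base (kermx A))%MS.
  rewrite eq_row_base; apply/sub_kermxP.
  by rewrite mulmxBl mul1mx mulmxKpV ?subrr.
case/submxP=> Z ZB; exists Z, (pinvmx A); split=> //; last first.
  by rewrite -ZB addrC subrK.
apply: (row_free_inj (row_base_free (kermx A))) => /=.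
by rewrite -mulmxA -ZB mulmxBr mulmx1 mulmxA BA mul0mx subr0 mul1mx.
Qed.

Lemma mx_cokernel m n (A : 'M[K]_(m, n)) :
  exists k (C : 'M_(n, k)) (W : 'M_(k, n)) (A' : 'M_(n, m)),
  [/\ A *m C = 0, W *m C = 1%:M & A' *m A + C *m W = 1%:M].
Proof.
have [k [B [Z [A' [BA BZ AZ]]]]] := mx_kernel A^T.
exists k, B^T, Z^T, A'^T; split; apply: trmx_inj.
- by rewrite trmx_mul trmxK BA trmx0.
- by rewrite trmx_mul !trmxK BZ trmx1.
- by rewrite linearD /= !trmx_mul !trmxK AZ trmx1.
Qed.
End MatrixSplitting.

(** * Elementary properties of semilinear maps *)

Section SemilinearTheory.
Variables (K K' : nzRingType) (s : K -> K') (M : lmodType K) (N : lmodType K').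
Variable f : M -> N.
Hypothesis fs : semilinear_for s f.

Lemma semi0 : f 0 = 0.
Proof. by apply: (addIr (f 0)); rewrite -(proj1 fs) !add0r. Qed.

Lemma semiN x : f (- x) = - f x.
Proof. by apply: (addIr (f x)); rewrite -(proj1 fs) !addNr semi0. Qed.

Lemma semiB x y : f (x - y) = f x - f y.
Proof. by rewrite (proj1 fs) semiN. Qed.

Lemma semi_sum (I : finType) (x : I -> M) : f (\sum_i x i) = \sum_i f (x i).
Proof. exact: (big_morph f (proj1 fs) semi0). Qed.

Lemma semi_inj : (forall x, f x = 0 -> x = 0) -> injective f.
Proof.
move=> f0 x y fxy; apply/eqP; rewrite -subr_eq0; apply/eqP/f0.
by rewrite semiB fxy subrr.
Qed.
End SemilinearTheory.

Section SigmaTriple.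
Variable T : sigma_triple.

Local Notation F := (st_F T).
Local Notation E := (st_E T).
Local Notation L := (st_L T).
Local Notation sigma := (st_sigma T).
Local Notation sigmaE := (st_sigmaE T).
Local Notation inc := (st_inc T).
Local Notation pr := (@st_pr T).
Local Notation "A ^s" := (map_mx sigma A) (at level 2, format "A ^s").
Local Notation "A ^e" := (map_mx (in_alg L) A) (at level 2, format "A ^e").
Local Notation "A ^i" :=
  (map_mx (in_alg L) (map_mx inc A)) (at level 2, format "A ^i").

(** * Fixed vectors over L *)

Lemma st_pr_inj (x y : L) : (forall l, pr l x = pr l y) -> x = y.
Proof.
move=> xy; have [z [_ zU]] := st_prodP (fun l => pr l y).
by rewrite -(zU y) // (zU x).
Qed.

Lemma st_lift (x : forall l, st_Ll l) : exists y : L, forall l, pr l y = x l.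
Proof. by have [y []] := st_prodP x; exists y. Qed.

Lemma idem_ex (l : 'I_(st_d T)) :
  exists e : L, forall k, pr k e = (k == l)%:R.
Proof. exact: st_lift. Qed.

Lemma idem_sum (e : 'I_(st_d T) -> L) :
  (forall l k, pr k (e l) = (k == l)%:R) -> \sum_l e l = 1.
Proof.
move=> eP; apply: st_pr_inj => k; rewrite rmorph_sum rmorph1 /=.
rewrite (bigD1 k) //= eP eqxx big1 ?addr0 // => l lk.
by rewrite eP eq_sym (negPf lk).
Qed.

(** Cyclicity only says that [sigma (e l)] vanishes outside [ordS l]. Its value there is found by
    applying sigma to the sum of all idempotents, which is 1: every other term is supported
    elsewhere. *)
Lemma sigma_idem (e : 'I_(st_d T) -> L) :
  (forall l k, pr k (e l) = (k == l)%:R) -> forall l, sigma (e l) = e (ordS l).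
Proof.
move=> eP.
have off l k : k != ordS l -> pr k (sigma (e l)) = 0.
  by apply: st_sigma_cyclic => j jl; rewrite eP (negPf jl).
move=> l; apply: st_pr_inj => k; rewrite eP.
have [->|/off //] := eqVneq k (ordS l).
have : pr (ordS l) (sigma (\sum_j e j)) = 1 by rewrite idem_sum // !rmorph1.
rewrite !rmorph_sum (bigD1 l) //= big1 ?addr0 // => j jl.
by rewrite off // (inj_eq (@ordS_inj _)) eq_sym.
Qed.

Lemma iter_ordS d (l k : 'I_d) : exists n, iter n (@ordS d) l = k.
Proof.
(* From [l], [d - l] steps lead back to 0, and [k] more lead to [k]. *)
exists (k + (d - l))%N; apply: val_inj.
have itE n : iter n (@ordS d) l = ((l + n) %% d)%N :> nat.
  elim: n => [|n IH] /=; first by rewrite addn0 modn_small.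
  by rewrite IH -addn1 modnDml addn1 addnS.
by rewrite /= itE addnCA subnKC 1?ltnW // modnDr modn_small.
Qed.

(** A nonzero element of the ideal has a nonzero coordinate in some field factor, so the ideal
    contains the idempotent of that factor. Iterating sigma yields all the idempotents, whose sum is
    1. *)
Lemma sigma_simple (I : L -> Prop) :
  I 0 -> (forall x y, I x -> I y -> I (x + y)) ->
  (forall c x, I x -> I (c * x)) -> (forall x, I x -> I (sigma x)) ->
  forall a, I a -> a != 0 -> I 1.
Proof.
move=> I0 ID IM Is a Ia a0; have [e eP] := choice idem_ex.
have [l al] : exists l, pr l a != 0.
  apply: contrapT => /forallNP al; case/eqP: a0; apply: st_pr_inj => l.
  by rewrite rmorph0; apply/eqP; apply: contrapT => /negP/al.
have Ie : I (e l).
  (* [b] inverts [a] in the factor [l] and is 0 in the others, where [a] may vanish. *)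
  have [b bP] := st_lift (fun k => (pr k a)^-1 * (k == l)%:R).
  suff -> : e l = b * a by apply: IM.
  apply: st_pr_inj => k; rewrite rmorphM /= bP eP.
  by have [->|_] := eqVneq k l; rewrite ?mulr1 ?mulVf // mulr0 mul0r.
rewrite -(idem_sum eP); apply: big_ind => // k _.
have [n <-] := iter_ordS l k; elim: n => //= n IH.
by rewrite -sigma_idem //; apply: Is.
Qed.

Lemma inc_alg_inj : injective (fun c : F => (inc c)%:A : L).
Proof. exact: (inj_comp (fmorph_inj (in_alg L)) (fmorph_inj inc)). Qed.

Lemma map_sigma_alg m n (A : 'M[E]_(m, n)) : (A^e)^s = (map_mx sigmaE A)^e.
Proof. by apply/matrixP=> i j; rewrite !mxE; apply: st_sigma_alg. Qed.

Lemma map_sigma_inc m n (A : 'M[F]_(m, n)) : (A^i)^s = A^i.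
Proof. by apply/matrixP=> i j; rewrite !mxE; apply/st_fixL; exists (A i j). Qed.

Lemma sigma_fixed_mx m n (X : 'M[L]_(m, n)) :
  X^s = X -> exists A : 'M[F]_(m, n), X = A^i.
Proof.
move=> Xs; have /choice[a aP] : forall p : 'I_m * 'I_n,
    exists c : F, X p.1 p.2 = (inc c)%:A.
  by case=> i j; apply/st_fixL; move/matrixP: Xs => /(_ i j); rewrite mxE.
exists (\matrix_(i, j) a (i, j)); apply/matrixP=> i j; rewrite !mxE.
exact: (aP (i, j)).
Qed.

Lemma map_inc_inj m n : injective (fun A : 'M[F]_(m, n) => A^i).
Proof.
move=> A B /matrixP AB; apply/matrixP=> i j.
by have := AB i j; rewrite !mxE => /inc_alg_inj.
Qed.

Lemma map_alg_inj m n : injective (fun A : 'M[E]_(m, n) => A^e).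
Proof.
move=> A B /matrixP AB; apply/matrixP=> i j.
by have := AB i j; rewrite !mxE => /(fmorph_inj (in_alg L)).
Qed.

(** Linear independence of the rows over [L], put as injectivity because [L] is not a field. *)
Definition row_indep m n (P : 'M[L]_(m, n)) : Prop :=
  forall u : 'rV[L]_m, u *m P = 0 -> u = 0.

(** Independence passes to one field factor, where rank applies: a relation between the projected
    rows lifts to [L], and multiplying it by the idempotent of the factor makes it a relation
    between the rows of [P]. *)
Lemma row_indep_le m n (P : 'M[L]_(m, n)) : row_indep P -> (m <= n)%N.
Proof.
move=> Pi; pose l := Ordinal (st_d_gt0 T).
have [e eP] := idem_ex l.
suff Pf : row_free (map_mx (pr l) P).
  by move/eqP: Pf => <-; apply: rank_leq_col.
rewrite -kermx_eq0; apply/eqP/row_matrixP=> i; rewrite row0.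
have : row i (kermx (map_mx (pr l) P)) *m map_mx (pr l) P = 0.
  by rewrite -row_mul mulmx_ker row0.
move: (row i _) => v vP.
(* Any lift would do, since [e] will kill the other coordinates; here they are 0, the entry being
   transported along [k = l]. *)
have /choice[w wP] (j : 'I_m) : exists y : L, pr l y = v 0 j.
  have [y yP] := st_lift (fun k => if @eqP _ k l is ReflectT kl
    then ecast k (st_Ll k) (esym kl) (v 0 j) else 0).
  by exists y; rewrite yP; case: eqP => // kl; rewrite (eq_axiomK kl).
have u0 : \row_j (e * w j) = 0.
  apply: Pi; apply/rowP=> k; apply: st_pr_inj => i'.
  rewrite !mxE rmorph0 rmorph_sum /=.
  have [->|i'l] := eqVneq i' l; last first.
    by apply: big1 => j _; rewrite !mxE !rmorphM /= eP (negPf i'l) !mul0r.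
  move/rowP: vP => /(_ k); rewrite !mxE; apply: etrans; apply: eq_bigr => j _.
  by rewrite !mxE !rmorphM /= eP eqxx mul1r wP.
apply/rowP=> j; move/rowP: u0 => /(_ j); rewrite !mxE => /(congr1 (pr l)).
by rewrite rmorph0 rmorphM /= eP eqxx mul1r wP.
Qed.

(* The coefficients of v in the L-linear relations between v and the rows of P
   form a nonzero sigma-stable ideal, hence v = u P with u over L; such a u is
   unique, and therefore fixed by sigma. *)
Lemma fixed_dependent m n (Phi : 'M[L]_n) (P : 'M[L]_(m, n)) (v : 'rV[L]_n) :
  P^s *m Phi = P -> row_indep P -> v^s *m Phi = v ->
  ~ row_indep (col_mx v P) -> exists c : 'rV[F]_m, v = c^i *m P.
Proof.
move=> Ps Pi vs dep.
pose I a := exists u : 'rV[L]_m, a *: v + u *m P = 0.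
have [a [Ia a0]] : exists a, I a /\ a != 0.
  apply: contrapT => noa; apply: dep => u.
  rewrite -(hsubmxK (u : 'rV_(1 + m))) mul_row_col.
  rewrite [lsubmx _]mx11_scalar mul_scalar_mx.
  set a := (lsubmx _) 0 0 => rel.
  have a0 : a = 0.
    by apply/eqP; apply: contrapT => /negP a0; apply: noa; exists a; split=> //;
      exists (rsubmx (u : 'rV_(1 + m))).
  move: rel; rewrite a0 scale0r add0r => /Pi ->.
  by rewrite -scalemx1 scale0r row_mx0.
have [||||u] := sigma_simple _ _ _ _ Ia a0.
- by exists 0; rewrite scale0r mul0mx addr0.
- move=> x y [u ux] [w wy]; exists (u + w).
  by rewrite scalerDl mulmxDl addrACA ux wy addr0.
- move=> c x [u ux]; exists (c *: u).
  by rewrite -scalerA -scalemxAl -scalerDr ux scaler0.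
(* Applying phi to a relation conjugates its coefficients only, because [v] and the rows of [P] are
   fixed. *)
- move=> x [u ux]; exists (u^s); rewrite -[in LHS]vs -[in LHS]Ps mulmxA -map_mxM.
  by rewrite scalemxAl -mulmxDl -map_mxZ -map_mxD ux map_mx0 mul0mx.
rewrite scale1r => vu; have {}vu : v = (- u) *m P.
  by rewrite mulNmx; apply/eqP; rewrite -addr_eq0; apply/eqP.
have [|c cP] := @sigma_fixed_mx 1 m (- u); last by exists c; rewrite -cP.
apply/eqP; rewrite -subr_eq0; apply/eqP; apply: Pi.
by rewrite mulmxBl -vu -[in X in _ - X]vs vu map_mxM -mulmxA Ps subrr.
Qed.

(** [P] is a longest independent family of fixed vectors: [row_indep_le] bounds its length, and by
    [fixed_dependent] a fixed vector outside its [F]-span would lengthen it. Nothing is claimed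
    about the [L]-span of [P] being everything; that is what triviality will add. *)
Lemma fixed_basis n (Phi : 'M[L]_n) : exists m (P : 'M[L]_(m, n)),
  [/\ P^s *m Phi = P, row_indep P
    & forall v : 'rV[L]_n, v^s *m Phi = v -> exists c : 'rV[F]_m, v = c^i *m P].
Proof.
pose Q m := `[< exists P : 'M[L]_(m, n), P^s *m Phi = P /\ row_indep P >].
have exQ : exists m, Q m.
  exists 0%N; apply/asboolP; exists 0; split; first by rewrite map_mx0 mul0mx.
  by move=> u _; apply: thinmx0.
have Qle m : Q m -> (m <= n)%N by case/asboolP=> P [_ /row_indep_le].
have [m /asboolP[P [Ps Pi]] mmax] := ex_maxnP exQ Qle.
exists m, P; split=> // v vs; apply: (fixed_dependent Ps Pi vs) => dep.
suff /mmax : Q m.+1 by rewrite ltnn.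
apply/asboolP; exists (col_mx v P); split; last exact: dep.
have vPs : (col_mx v P)^s *m Phi = col_mx v P.
  by rewrite map_col_mx mul_col_mx vs Ps.
exact: vPs.
Qed.

(* phi acts on row vectors by v |-> v^s *m Phi, so the rows of P are fixed. P is
   not assumed square, which spares any comparison of dimensions. *)
Definition mx_trivial m n (Phi : 'M[L]_n) (P : 'M[L]_(m, n))
    (P' : 'M[L]_(n, m)) : Prop :=
  [/\ P^s *m Phi = P, P *m P' = 1%:M & P' *m P = 1%:M].

Lemma mx_trivial_hom m m' n n' (Phi : 'M[L]_n) (Phi' : 'M[L]_n')
    (P : 'M[L]_(m, n)) (P' : 'M[L]_(n, m))
    (R : 'M[L]_(m', n')) (R' : 'M[L]_(n', m')) (A : 'M[L]_(n, n')) :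
  mx_trivial Phi P P' -> mx_trivial Phi' R R' -> Phi *m A = A^s *m Phi' ->
  exists G : 'M[F]_(m, m'), G^i *m R = P *m A /\ P' *m G^i = A *m R'.
Proof.
move=> [Ps PP' P'P] [Rs RR' R'R] hA.
have GE : P *m A *m R' *m R = P *m A by rewrite -mulmxA R'R mulmx1.
have [|G GP] := @sigma_fixed_mx _ _ (P *m A *m R').
  (* Since [R] is cancelled by [R'], the equality of the candidate with its conjugate may be tested
     after multiplication by [R]. *)
  suff H : (P *m A *m R')^s *m R = P *m A.
    by rewrite -[LHS]mulmx1 -RR' mulmxA H.
  by rewrite -[in LHS]Rs mulmxA -map_mxM GE map_mxM -mulmxA -hA mulmxA Ps.
by exists G; rewrite -GP; split=> //; rewrite !mulmxA P'P mul1mx.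
Qed.

Lemma mx_trivial_ker n n' (PhiM : 'M[E]_n) (PhiN : 'M[E]_n') (A : 'M[E]_(n, n'))
    m m' (P : 'M[L]_(m, n)) P' (R : 'M[L]_(m', n')) R' :
  mx_trivial PhiM^e P P' -> mx_trivial PhiN^e R R' ->
  PhiM *m A = map_mx sigmaE A *m PhiN ->
  exists k (PhiK : 'M[E]_k) (B : 'M[E]_(k, n)) (Z : 'M[E]_(n, k))
    (A' : 'M[E]_(n', n)),
  [/\ [/\ B *m A = 0, B *m Z = 1%:M & A *m A' + Z *m B = 1%:M],
      PhiK *m B = map_mx sigmaE B *m PhiM
    & exists j (Y : 'M[L]_(j, k)) Y', mx_trivial PhiK^e Y Y'].
Proof.
move=> tM tN hA; have [k [B [Z [A' [BA BZ AZ]]]]] := mx_kernel A.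
have [|G [GR PG]] := @mx_trivial_hom _ _ _ _ _ _ _ _ _ _ A^e tM tN.
  by rewrite map_sigma_alg -!map_mxM hA.
have [j [X0 [Z0 [G' [XG XZ GZ]]]]] := mx_kernel G.
case: tM tN => [Ps PP' P'P] [Rs RR' R'R].
(* The kernel is stable under phi: the rows of [map_mx sigmaE B *m PhiM] are killed by [A], and
   [Z *m B] acts as the identity on such rows. *)
have hB : map_mx sigmaE B *m PhiM *m Z *m B = map_mx sigmaE B *m PhiM.
  rewrite -mulmxA.
  have -> : Z *m B = 1%:M - A *m A' by rewrite -AZ addrC addKr.
  rewrite mulmxBr mulmx1 -mulmxA; apply/eqP; rewrite subr_eq addrC -subr_eq subrr.
  by rewrite (mulmxA PhiM) hA !mulmxA -map_mxM BA map_mx0 !mul0mx.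
exists k, (map_mx sigmaE B *m PhiM *m Z), B, Z, A'; split=> //.
(* The rows of [X0^i *m P] are fixed vectors killed by [A], because
   [X0^i *m P *m A^e = X0^i *m G^i *m R = 0]; [Z] gives their coordinates in the rows of [B]. The
   inverse takes the rows of [B] to their coordinates in [P], then in [X0]. *)
exists j, (X0^i *m P *m Z^e), (B^e *m P' *m Z0^i).
have ZBe : Z^e *m B^e = 1%:M - A^e *m A'^e.
  by rewrite -!map_mxM -(map_mx1 (in_alg L)) -AZ map_mxD addrC addKr.
have ZXi : Z0^i *m X0^i = 1%:M - G^i *m G'^i.
  by rewrite -!map_mxM -(map_mx1 (in_alg L)) -(map_mx1 inc) -GZ !map_mxD addrC addKr.
have BZe : B^e *m Z^e = 1%:M by rewrite -map_mxM BZ map_mx1.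
have XZi : X0^i *m Z0^i = 1%:M by rewrite -!map_mxM XZ !map_mx1.
have YB : X0^i *m P *m Z^e *m B^e = X0^i *m P.
  rewrite -mulmxA ZBe mulmxBr mulmx1 -!mulmxA (mulmxA P) -GR !mulmxA.
  by rewrite -!map_mxM XG !map_mx0 !mul0mx subr0.
have YX : B^e *m P' *m Z0^i *m X0^i = B^e *m P'.
  rewrite -mulmxA ZXi mulmxBr mulmx1 -!mulmxA (mulmxA P') PG !mulmxA.
  by rewrite -map_mxM BA map_mx0 !mul0mx subr0.
split.
- have BI : injective (fun V : 'M[L]_(j, k) => V *m B^e).
    by apply: (can_inj (g := mulmx^~ Z^e)) => V; rewrite -mulmxA BZe mulmx1.
  apply: BI => /=; rewrite YB -mulmxA -map_mxM hB map_mxM -map_sigma_alg mulmxA.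
  by rewrite -map_mxM YB map_mxM map_sigma_inc -mulmxA Ps.
- by rewrite !mulmxA YB -(mulmxA _ P) PP' mulmx1.
- by rewrite !mulmxA YX -(mulmxA _ P') P'P mulmx1.
Qed.

Lemma mx_trivial_coker n n' (PhiM : 'M[E]_n) (PhiN : 'M[E]_n')
    (A : 'M[E]_(n, n')) m m' (P : 'M[L]_(m, n)) P' (R : 'M[L]_(m', n')) R' :
  mx_trivial PhiM^e P P' -> mx_trivial PhiN^e R R' ->
  PhiM *m A = map_mx sigmaE A *m PhiN ->
  exists k (PhiQ : 'M[E]_k) (C : 'M[E]_(n', k)) (W : 'M[E]_(k, n'))
    (A' : 'M[E]_(n', n)),
  [/\ [/\ A *m C = 0, W *m C = 1%:M & A' *m A + C *m W = 1%:M],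
      PhiN *m C = map_mx sigmaE C *m PhiQ
    & exists j (Y : 'M[L]_(j, k)) Y', mx_trivial PhiQ^e Y Y'].
Proof.
move=> tM tN hA; have [k [C [W [A' [AC WC AW]]]]] := mx_cokernel A.
have [|G [GR PG]] := @mx_trivial_hom _ _ _ _ _ _ _ _ _ _ A^e tM tN.
  by rewrite map_sigma_alg -!map_mxM hA.
have [j [C0 [W0 [G' [GC WC0 GW]]]]] := mx_cokernel G.
case: tM tN => [Ps PP' P'P] [Rs RR' R'R].
(* phi passes to the quotient: [C *m W] differs from the identity by [A' *m A], and the conjugate of
   [A] times [PhiN *m C] is [PhiM *m A *m C = 0]. *)
have hC : PhiN *m C = map_mx sigmaE C *m (map_mx sigmaE W *m PhiN *m C).
  have -> : map_mx sigmaE C *m (map_mx sigmaE W *m PhiN *m C) =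
      map_mx sigmaE (C *m W) *m PhiN *m C by rewrite map_mxM !mulmxA.
  have -> : C *m W = 1%:M - A' *m A by rewrite -AW addrC addKr.
  rewrite map_mxB map_mx1 !mulmxBl mul1mx map_mxM -(mulmxA _ (map_mx _ A)) -hA.
  by rewrite -!mulmxA AC !mulmx0 subr0.
exists k, (map_mx sigmaE W *m PhiN *m C), C, W, A'; split=> //.
(* [W0] lifts a basis of the cokernel of [G] over [F]; [R] turns it into fixed vectors, whose images
   under [C] form the basis sought. *)
exists j, (W0^i *m R *m C^e), (W^e *m R' *m C0^i).
have CWe : C^e *m W^e = 1%:M - A'^e *m A^e.
  by rewrite -!map_mxM -(map_mx1 (in_alg L)) -AW map_mxD addrC addKr.
have CWi : C0^i *m W0^i = 1%:M - G'^i *m G^i.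
  by rewrite -!map_mxM -(map_mx1 (in_alg L)) -(map_mx1 inc) -GW !map_mxD addrC addKr.
have WCe : W^e *m C^e = 1%:M by rewrite -map_mxM WC map_mx1.
have WCi : W0^i *m C0^i = 1%:M by rewrite -!map_mxM WC0 !map_mx1.
have CR : C^e *m (W^e *m R' *m C0^i) = R' *m C0^i.
  rewrite !mulmxA CWe !mulmxBl mul1mx -!mulmxA (mulmxA A^e) -PG -mulmxA.
  by rewrite -!map_mxM GC !map_mx0 !mulmx0 subr0.
have CC : C0^i *m (W0^i *m R *m C^e) = R *m C^e.
  rewrite !mulmxA CWi !mulmxBl mul1mx -!mulmxA (mulmxA G^i) GR -mulmxA.
  by rewrite -!map_mxM AC !map_mx0 !mulmx0 subr0.
split.
- have hCe : (C^e)^s *m (map_mx sigmaE W *m PhiN *m C)^e = PhiN^e *m C^e.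
    by rewrite map_sigma_alg -!map_mxM -hC.
  by rewrite map_mxM -mulmxA hCe map_mxM map_sigma_inc mulmxA -(mulmxA _ R^s) Rs.
- by rewrite -(mulmxA _ C^e) CR -!mulmxA (mulmxA R) RR' mul1mx.
- by rewrite -(mulmxA _ C0^i) CC -!mulmxA (mulmxA R') R'R mul1mx.
Qed.

(** * L-triviality and bases of fixed vectors *)

Section Action.
Variable M : lmodType E.

(** The action of [L] on L (x) M; the tensor product itself carries only an [E]-module structure. *)
Definition lact (l : L) : tens L M -> tens L M := tens_map ( *%R l) (@id M).

Lemma lact_tpure l l' (x : M) : lact l (tpure l' x) = tpure (l * l') x.
Proof. exact: tens_map_tpure (mulr_semi l) (semi_id M) l' x. Qed.

Lemma lactDr l : {morph lact l : s t / s + t}.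
Proof. exact: tens_mapD (mulr_semi l) (semi_id M). Qed.

Lemma lact_sumr l (I : finType) (t : I -> tens L M) :
  lact l (\sum_i t i) = \sum_i lact l (t i).
Proof. exact: (semi_sum (tens_map_semi (mulr_semi l) (semi_id M))). Qed.

Lemma lactDl l l' t : lact (l + l') t = lact l t + lact l' t.
Proof.
move: t; apply: tens_ext => [s t|s t|k x]; rewrite ?lactDr //.
  by rewrite addrACA.
by rewrite !lact_tpure mulrDl tpureDl.
Qed.

Lemma lactM l l' t : lact l (lact l' t) = lact (l * l') t.
Proof.
move: t; apply: tens_ext => [s t|s t|k x]; rewrite ?lactDr //.
by rewrite !lact_tpure mulrA.
Qed.

Lemma lactZ (a : E) t : lact a%:A t = a *: t.
Proof.
move: t; apply: tens_ext => [s t|s t|k x]; rewrite ?lactDr ?scalerDr //.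
by rewrite lact_tpure mulr_algl tpureZl.
Qed.
End Action.

Section BaseChange.
Variables (M N : lmodType E) (h : M -> N).
Hypothesis hs : semilinear_for id h.

Local Notation Lmap := (tens_map (@id L) h).

Lemma Lmap_semi : semilinear_for id Lmap.
Proof. exact: tens_map_semi (semi_id L) hs. Qed.

Lemma LmapD : {morph Lmap : s t / s + t}.
Proof. exact: (proj1 Lmap_semi). Qed.

Lemma Lmap_tpure l x : Lmap (tpure l x) = tpure l (h x).
Proof. exact: tens_map_tpure (semi_id L) hs l x. Qed.

Lemma Lmap_lact l t : Lmap (lact l t) = lact l (Lmap t).
Proof.
move: t; apply: tens_ext => [s t|s t|k x]; rewrite ?(lactDr, LmapD) //.
by rewrite !(lact_tpure, Lmap_tpure).
Qed.
End BaseChange.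

Lemma phiL_lact (M : phimod T) l (t : tens L M) :
  phiL (lact l t) = lact (sigma l) (phiL t).
Proof.
have D := proj1 (phiL_semi M).
move: t; apply: tens_ext => [s t|s t|k x]; rewrite ?(lactDr, D) //.
by rewrite !(lact_tpure, phiL_tpure) rmorphM.
Qed.

Lemma Vval_sum (M : phimod T) (I : finType) (v : I -> Vmod M) :
  Vval (\sum_i v i) = \sum_i Vval (v i).
Proof. exact: (big_morph (@Vval T M) (@VvalD T M) erefl). Qed.

Lemma Vval_scale (M : phimod T) (a : F) (v : Vmod M) :
  Vval (a *: v) = lact (inc a)%:A (Vval v).
Proof. by rewrite lactZ. Qed.

(* An L-basis of L (x) M inside V(M) together with its dual basis: a
   coordinate-free witness of L-triviality. *)
Definition frame (M : phimod T) (I : finType) (v : I -> Vmod M)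
    (c : I -> tens L M -> L) : Prop :=
  [/\ forall i, {morph c i : s t / s + t},
      forall i l t, c i (lact l t) = l * c i t,
      forall i j, c i (Vval (v j)) = (i == j)%:R
    & forall t, t = \sum_i lact (c i t) (Vval (v i))].

Section FrameTheory.
Variables (M : phimod T) (I : finType) (v : I -> Vmod M).
Variable c : I -> tens L M -> L.
Hypothesis vc : frame v c.

Lemma frame_comb i (l : I -> L) : c i (\sum_j lact (l j) (Vval (v j))) = l i.
Proof.
case: vc => cD cZ cv _.
have c0 : c i 0 = 0 by apply: (addIr (c i 0)); rewrite -cD !add0r.
rewrite (big_morph (c i) (cD i) c0) (bigD1 i) //= big1 => [|j ji].
  by rewrite cZ cv eqxx mulr1 addr0.
by rewrite cZ cv eq_sym (negPf ji) mulr0.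
Qed.

(** Applying phi to the expansion of [w] in the frame only applies sigma to the coefficients. These
    are unique, hence fixed by sigma, hence in [F]. *)
Lemma frame_fixed (w : Vmod M) : exists a : I -> F,
  w = \sum_i a i *: v i /\ forall i, c i (Vval w) = (inc (a i))%:A.
Proof.
case: (vc) => _ _ _ cE.
have /choice[a aP] i : exists a : F, c i (Vval w) = (inc a)%:A.
  apply/st_fixL; rewrite -[in RHS]VvalP [in RHS](cE (Vval w)).
  rewrite (semi_sum (phiL_semi M)).
  under [in RHS]eq_bigr do rewrite phiL_lact VvalP.
  by rewrite frame_comb.
exists a; split=> //; apply: Vval_inj; rewrite Vval_sum [LHS]cE.
by apply: eq_bigr => i _; rewrite aP Vval_scale.
Qed.

(** The coefficients of a fixed vector lie in [F], so they cross the tensor sign. On this normal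
    form the natural map is visibly inverted by the coordinates [c i]. *)
Lemma frame_span (s : tens (restr inc L) (Vmod M)) :
  exists l : I -> L, s = \sum_i tpure (l i : restr inc L) (v i).
Proof.
have D := tpureDl (M := restr inc L) (N := Vmod M).
elim/tens_ind: s => [|l w|s t [l ->] [k ->]].
- exists (fun _ => 0); rewrite big1 // => i _.
  exact: balanced0 (balanced_tpure (restr inc L) (Vmod M)).
- have [a [-> _]] := frame_fixed w; rewrite tpure_sumr.
  exists (fun i => a i *: l); apply: eq_bigr => i _.
  by rewrite tpureZr -tpureZl.
- exists (fun i => l i + k i); rewrite -big_split.
  by apply: eq_bigr => i _; apply: esym; apply: D.
Qed.

Lemma frame_trivial : fin_dim M -> L_trivial M.
Proof.
move=> Mf; split=> //; case: (vc) => _ _ _ cE.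
have nD : {morph @natural_map T M : s t / s + t}.
  exact: tens_liftD (natural_map_bal M).
have n0 : @natural_map T M 0 = 0.
  by apply: (addIr (natural_map 0)); rewrite -nD !add0r.
have nE (l : I -> L) : natural_map (\sum_i tpure (l i : restr inc L) (v i)) =
    \sum_i lact (l i) (Vval (v i)).
  rewrite (big_morph _ nD n0); apply: eq_bigr => i _.
  exact: natural_map_tpure.
apply: inj_surj_bij => [s t|t].
  have [[l ->] [k ->]] := (frame_span s, frame_span t).
  rewrite !nE => lk; apply: eq_bigr => i _; congr tpure.
  by have := congr1 (c i) lk; rewrite !frame_comb.
exists (\sum_i tpure (c i t : restr inc L) (v i)).
by rewrite nE -cE.
Qed.
End FrameTheory.

Lemma frame_Vfin_dim (M : phimod T) m (v : 'I_m -> Vmod M) c :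
  frame v c -> fin_dim (Vmod M).
Proof.
move=> vc; pose g (a : 'rV[F]_m) : Vmod M := \sum_i a 0 i *: v i.
have cg a i : c i (Vval (g a)) = (inc (a 0 i))%:A.
  rewrite Vval_sum; under eq_bigr do rewrite Vval_scale.
  exact: (frame_comb vc).
have gI : injective g.
  move=> a b ab; apply/rowP=> i; apply: inc_alg_inj.
  by rewrite -!cg ab.
have /choice[f fK] w : exists a, g a = w.
  have [a [-> _]] := frame_fixed vc w; exists (\row_i a i).
  by apply: eq_bigr => i _; rewrite mxE.
exists m; constructor; exists f; last first.
  by exists g => // a; apply: gI; rewrite fK.
move=> a x y; apply: gI; rewrite fK -[in LHS](fK x) -[in LHS](fK y).
rewrite /g scaler_sumr -big_split; apply: eq_bigr => i _.
by rewrite !mxE scalerDl scalerA.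
Qed.

Definition coords (K : fieldType) (M : lmodType K) n (f : M -> 'rV[K]_n)
    (g : 'rV[K]_n -> M) : Prop :=
  [/\ semilinear_for id f, cancel f g & cancel g f].

Lemma fin_dimP (K : fieldType) (M : lmodType K) :
  fin_dim M <-> exists n (f : M -> 'rV[K]_n) g, coords f g.
Proof.
split=> [[n [[f fl [g fg gf]]]]|[n [f [g [fl fg gf]]]]].
  by exists n, f, g; split=> //; apply/semilinear_forP.
by exists n; constructor; exists f; [apply/semilinear_forP|exists g].
Qed.

Lemma coords_semi (K : fieldType) (M : lmodType K) n (f : M -> 'rV[K]_n) g :
  coords f g -> semilinear_for id g.
Proof.
case=> -[fD fZ] fg gf.
by split=> [x y|a x]; apply: (can_inj fg); rewrite ?fD ?fZ !gf.
Qed.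

Lemma coords_sum (K : fieldType) (M : lmodType K) n (f : M -> 'rV[K]_n) g x :
  coords f g -> x = \sum_i f x 0 i *: g (delta_mx 0 i).
Proof.
move=> fg; have gs := coords_semi fg; case: fg => _ fg gf.
rewrite -[LHS]fg [in LHS](row_sum_delta (f x)) (semi_sum gs).
by apply: eq_bigr => i _; rewrite (proj2 gs).
Qed.

Section Coordinates.
Variables (M : lmodType E) (n : nat) (f : M -> 'rV[E]_n) (g : 'rV[E]_n -> M).
Hypothesis fg : coords f g.

Definition Lcoord : tens L M -> 'rV[L]_n :=
  tens_lift (fun (l : L) x => l *: (f x)^e).

Definition Lcoord_inv (v : 'rV[L]_n) : tens L M :=
  \sum_i tpure (v 0 i) (g (delta_mx 0 i)).

Fact Lcoord_bal : balanced (fun (l : L) x => l *: (f x)^e).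
Proof.
case: fg => -[fD fZ] _ _; split=> [x l l'|l x y|a l x].
- by rewrite scalerDl.
- by rewrite fD map_mxD scalerDr.
- by rewrite fZ map_mxZ scalerA /= mulr_algr.
Qed.

Lemma Lcoord_tpure l x : Lcoord (tpure l x) = l *: (f x)^e.
Proof. exact: tens_lift_tpure Lcoord_bal. Qed.

Lemma LcoordD : {morph Lcoord : s t / s + t}.
Proof. exact: tens_liftD Lcoord_bal. Qed.

Lemma Lcoord_lact l t : Lcoord (lact l t) = l *: Lcoord t.
Proof.
move: t; apply: tens_ext => [s t|s t|k x].
- by rewrite lactDr LcoordD.
- by rewrite LcoordD scalerDr.
- by rewrite lact_tpure !Lcoord_tpure scalerA.
Qed.

Lemma LcoordK : cancel Lcoord Lcoord_inv.
Proof.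
apply: tens_ext => [s t|//|l x].
  rewrite LcoordD /Lcoord_inv -big_split; apply: eq_bigr => i _.
  by rewrite mxE tpureDl.
rewrite Lcoord_tpure [in RHS](coords_sum x fg) tpure_sumr.
by apply: eq_bigr => i _; rewrite !mxE tpureZr -tpureZl mulr_algr.
Qed.

Lemma Lcoord_invK : cancel Lcoord_inv Lcoord.
Proof.
move=> v; have c0 : Lcoord 0 = 0.
  by apply: (addIr (Lcoord 0)); rewrite -LcoordD !add0r.
rewrite (big_morph _ LcoordD c0) [RHS]row_sum_delta.
case: fg => _ _ gf; apply: eq_bigr => i _.
by rewrite Lcoord_tpure gf map_delta_mx.
Qed.
End Coordinates.

(** In coordinates this is the inclusion of row vectors over [E] into row vectors over [L].
    Faithfulness of [V] depends on it. *)
Lemma tpure1_inj (M : lmodType E) :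
  fin_dim M -> injective (fun x : M => tpure (1 : L) x).
Proof.
case/fin_dimP=> n [f [g fg]] x y /(congr1 (Lcoord f)).
rewrite !(Lcoord_tpure fg) !scale1r => /map_alg_inj.
by case: fg => _ fK _; apply: (can_inj fK).
Qed.

Section HomMatrix.
Variables (s : E -> E) (M N : lmodType E) (m n : nat).
Variables (fM : M -> 'rV[E]_m) (gM : 'rV[E]_m -> M).
Variables (fN : N -> 'rV[E]_n) (gN : 'rV[E]_n -> N).
Hypotheses (cM : coords fM gM) (cN : coords fN gN).
Variable h : M -> N.
Hypothesis hs : semilinear_for s h.

(** The twist [s] is left free so that phi ([s = sigmaE]) and morphisms ([s = id]) share one notion
    of matrix. *)
Definition hom_mx : 'M[E]_(m, n) := \matrix_(i < m) fN (h (gM (delta_mx 0 i))).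

Lemma hom_mxE x : fN (h x) = map_mx s (fM x) *m hom_mx.
Proof.
case: (cN) => fs _ _; rewrite [in LHS](coords_sum x cM).
rewrite (semi_sum hs) (semi_sum fs) mulmx_sum_row; apply: eq_bigr => i _.
by rewrite (proj2 hs) (proj2 fs) rowK mxE.
Qed.
End HomMatrix.

Section PhiMatrix.
Variables (M : phimod T) (n : nat) (f : M -> 'rV[E]_n) (g : 'rV[E]_n -> M).
Hypothesis fg : coords f g.

Definition phi_mx : 'M[E]_n := hom_mx g f (pm_phi (p := M)).

Lemma phi_mxE x : f (pm_phi x) = map_mx sigmaE (f x) *m phi_mx.
Proof. exact: (hom_mxE fg fg (pm_phiP M)). Qed.

Lemma Lcoord_phi t : Lcoord f (phiL t) = (Lcoord f t)^s *m phi_mx^e.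
Proof.
have D := LcoordD fg.
move: t; apply: tens_ext => [s t|s t|l x].
- by rewrite (proj1 (phiL_semi M)) D.
- by rewrite D map_mxD mulmxDl.
- rewrite phiL_tpure !(Lcoord_tpure fg) phi_mxE map_mxM -map_sigma_alg.
  by rewrite map_mxZ scalemxAl.
Qed.

Lemma mx_trivial_frame m (P : 'M[L]_(m, n)) P' : mx_trivial phi_mx^e P P' ->
  exists (v : 'I_m -> Vmod M) c, frame v c.
Proof.
case=> Ps PP' P'P.
have vP j : phiL (Lcoord_inv g (row j P)) = Lcoord_inv g (row j P).
  apply: (can_inj (LcoordK fg)); rewrite Lcoord_phi !(Lcoord_invK fg).
  by rewrite map_row -row_mul Ps.
exists (fun j => V_of (vP j)), (fun j t => (Lcoord f t *m P') 0 j).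
split=> [i s t|i l t|i j|t].
- by rewrite (LcoordD fg) mulmxDl mxE.
- by rewrite (Lcoord_lact fg) -scalemxAl mxE.
- by rewrite (Lcoord_invK fg) -row_mul PP' mxE mxE eq_sym.
- apply: (can_inj (LcoordK fg)).
  have c0 : Lcoord f 0 = 0.
    by apply: (addIr (Lcoord f 0)); rewrite -(LcoordD fg) !add0r.
  rewrite (big_morph _ (LcoordD fg) c0) -[LHS]mulmx1 -P'P mulmxA mulmx_sum_row.
  by apply: eq_bigr => i _; rewrite (Lcoord_lact fg) (Lcoord_invK fg).
Qed.

(** The image of the natural map is the [L]-span of the fixed vectors, that is of the rows of the
    [P] given by [fixed_basis]. So each standard basis vector is a combination of these rows, and
    the coefficients form an inverse of [P]. *)
Lemma L_trivial_mx : L_trivial M ->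
  exists m (P : 'M[L]_(m, n)) P', mx_trivial phi_mx^e P P'.
Proof.
case=> _ [nI _ nK]; have [m [P [Ps Pi Pf]]] := fixed_basis phi_mx^e.
have D := LcoordD fg.
have span s : exists u : 'rV[L]_m, Lcoord f (natural_map s) = u *m P.
  have nD : {morph @natural_map T M : s t / s + t}.
    exact: tens_liftD (natural_map_bal M).
  elim/tens_ind: s => [|l w|s t [u us] [w wt]].
  - exists 0; rewrite mul0mx; apply: (addIr (Lcoord f (natural_map 0))).
    by rewrite -D -nD !add0r.
  - have [|c cP] := Pf (Lcoord f (Vval w)); first by rewrite -Lcoord_phi VvalP.
    exists (l *: c^i).
    by rewrite natural_map_tpure (Lcoord_lact fg) cP scalemxAl.
  - by exists (u + w); rewrite nD D us wt mulmxDl.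
have /choice[u uP] i : exists u : 'rV[L]_m, delta_mx 0 i = u *m P.
  have [u] := span (nI (Lcoord_inv g (delta_mx 0 i))).
  by rewrite nK (Lcoord_invK fg) => uP; exists u.
pose U := \matrix_i u i.
have UP : U *m P = 1%:M by apply/row_matrixP=> i; rewrite row_mul rowK -uP row1.
(* The other inverse law follows from independence: [(P *m U - 1%:M) *m P = 0] by [UP]. *)
exists m, P, U; split=> //; apply/row_matrixP=> i; apply/eqP; rewrite -subr_eq0.
apply/eqP; apply: Pi; rewrite mulmxBl -!row_mul -mulmxA UP mulmx1 mul1mx.
exact: subrr.
Qed.
End PhiMatrix.

Lemma L_trivial_frame (M : phimod T) :
  L_trivial M -> exists m (v : 'I_m -> Vmod M) c, frame v c.
Proof.
move=> Mt; have /fin_dimP[n [f [g fg]]] := proj1 Mt.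
have [m [P [P' PP]]] := L_trivial_mx fg Mt.
by exists m; apply: mx_trivial_frame PP.
Qed.

Lemma mx_L_trivial (M : phimod T) n (f : M -> 'rV[E]_n) g m P (P' : 'M_(n, m)) :
  coords f g -> mx_trivial (phi_mx f g)^e P P' -> L_trivial M.
Proof.
move=> fg /(mx_trivial_frame fg)[v [c vc]]; apply: frame_trivial vc _.
by apply/fin_dimP; exists n, f, g.
Qed.

Lemma L_trivial_Vfin_dim (M : phimod T) : L_trivial M -> fin_dim (Vmod M).
Proof. by case/L_trivial_frame=> m [v [c]]; apply: frame_Vfin_dim. Qed.

(** * Kernels and cokernels *)

Lemma phi_hom_ext (M N : phimod T) (f g : phi_hom M N) :
  phi_fun f =1 phi_fun g -> f = g.
Proof. by move=> fg; apply: val_inj; apply/funext. Qed.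

Lemma lin_map_ext (K : fieldType) (M N : lmodType K) (f g : lin_map M N) :
  val f =1 val g -> f = g.
Proof. by move=> fg; apply: val_inj; apply/funext. Qed.

Section Factorization.
Variables (K : nzRingType) (A B C : lmodType K).

Lemma factor_inj (k : A -> B) (g : C -> B) :
  semilinear_for id k -> semilinear_for id g -> injective k ->
  (forall x, exists a, k a = g x) ->
  exists h : C -> A, semilinear_for id h /\ forall x, k (h x) = g x.
Proof.
move=> [kD kZ] [gD gZ] kI /choice[h hP]; exists h; split=> //.
by split=> [x y|a x]; apply: kI; rewrite ?(kD, kZ) !hP ?(gD, gZ).
Qed.

Lemma factor_surj (c : A -> B) (g : A -> C) :
  semilinear_for id c -> semilinear_for id g -> (forall y, exists x, c x = y) ->
  (forall x, c x = 0 -> g x = 0) ->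
  exists h : B -> C, semilinear_for id h /\ forall x, h (c x) = g x.
Proof.
move=> cs gs /choice[r rP] cg.
have hP x : g (r (c x)) = g x.
  apply/eqP; rewrite -subr_eq0 -(semiB gs); apply/eqP/cg.
  by rewrite (semiB cs) rP subrr.
exists (g \o r); split=> //; split=> [x y|a x] /=.
  by rewrite -[in LHS](rP x) -[in LHS](rP y) -(proj1 cs) hP (proj1 gs).
by rewrite -[in LHS](rP x) -(proj2 cs) hP (proj2 gs).
Qed.
End Factorization.

Section Criteria.
Variables M N P : phimod T.

Lemma phi_kernel_factor (k : phi_hom M N) (f : phi_hom N P) :
  injective (phi_fun k) ->
  (forall y, phi_fun f y = 0 <-> exists x, phi_fun k x = y) ->
  phi_comp f k = 0 /\ forall W (g : phi_hom W N), phi_comp f g = 0 ->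
    exists! h : phi_hom W M, phi_comp k h = g.
Proof.
move=> kI kf; split=> [|W g fg0].
  by apply: phi_hom_ext => x; apply/kf; exists x.
have [ks kphi] := phi_homP k; have [gs gphi] := phi_homP g.
have [|h [hs hP]] := factor_inj ks gs kI.
  by move=> x; apply/kf; exact: (congr1 (fun h => phi_fun h x) fg0).
have hphi x : h (pm_phi x) = pm_phi (h x).
  by apply: kI; rewrite hP gphi kphi hP.
exists (phi_of hs hphi); split; first exact: phi_hom_ext.
by move=> h' kh; apply: phi_hom_ext => x; apply: kI; rewrite [LHS]hP -kh.
Qed.

Lemma phi_cokernel_factor (c : phi_hom N P) (f : phi_hom M N) :
  (forall z, exists y, phi_fun c y = z) ->
  (forall y, phi_fun c y = 0 <-> exists x, phi_fun f x = y) ->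
  phi_comp c f = 0 /\ forall W (g : phi_hom N W), phi_comp g f = 0 ->
    exists! h : phi_hom P W, phi_comp h c = g.
Proof.
move=> cS cf; split=> [|W g gf0].
  by apply: phi_hom_ext => x; apply/cf; exists x.
have [cs cphi] := phi_homP c; have [gs gphi] := phi_homP g.
have [|h [hs hP]] := factor_surj cs gs cS.
  by move=> y /cf[x <-]; exact: (congr1 (fun h => phi_fun h x) gf0).
have hphi z : h (pm_phi z) = pm_phi (h z).
  by have [y <-] := cS z; rewrite -cphi !hP gphi.
exists (phi_of hs hphi); split; first exact: phi_hom_ext.
move=> h' hc; apply: phi_hom_ext => z; have [y <-] := cS z.
by rewrite [LHS]hP -hc.
Qed.
End Criteria.

Section TrivialCriteria.
Variables X Y Z : trivial_cat T.

(** The subcategory is full, so a universal property that holds among all phi-modules restricts to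
    it. *)
Lemma trivial_kernel (k : phi_hom (sval X) (sval Y))
    (f : phi_hom (sval Y) (sval Z)) :
  injective (phi_fun k) ->
  (forall y, phi_fun f y = 0 <-> exists x, phi_fun k x = y) ->
  @is_kernel _ (trivial_cat T) X Y Z k f.
Proof.
move=> kI kf; have [fk kU] := phi_kernel_factor kI kf.
by split=> [|W g]; [exact: fk | exact: (kU (sval W) g)].
Qed.

Lemma trivial_cokernel (c : phi_hom (sval Y) (sval Z))
    (f : phi_hom (sval X) (sval Y)) :
  (forall z, exists y, phi_fun c y = z) ->
  (forall y, phi_fun c y = 0 <-> exists x, phi_fun f x = y) ->
  @is_cokernel _ (trivial_cat T) X Y Z c f.
Proof.
move=> cS cf; have [fc cU] := phi_cokernel_factor cS cf.
by split=> [|W g]; [exact: fc | exact: (cU (sval W) g)].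
Qed.
End TrivialCriteria.

Section LinearCriteria.
Variables (K : fieldType) (X Y Z : vec_cat K).

Lemma vec_kernel (k : lin_map (sval X) (sval Y)) (f : lin_map (sval Y) (sval Z)) :
  injective (val k) -> (forall y, val f y = 0 <-> exists x, val k x = y) ->
  @is_kernel _ (vec_cat K) X Y Z k f.
Proof.
move=> kI kf.
suff [fk kU] : lin_comp f k = 0 /\ forall W (g : lin_map W (sval Y)),
    lin_comp f g = 0 -> exists! h : lin_map W (sval X), lin_comp k h = g.
  split=> [|W g]; first exact: fk.
  exact: (kU (sval W) g).
split=> [|W g fg0].
  by apply: lin_map_ext => x; apply/kf; exists x.
have [|h [hs hP]] := factor_inj (lin_mapP k) (lin_mapP g) kI.
  by move=> x; apply/kf; exact: (congr1 (fun h : lin_map _ _ => val h x) fg0).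
exists (lin_of hs); split; first exact: lin_map_ext.
by move=> h' kh; apply: lin_map_ext => x; apply: kI; rewrite [LHS]hP -kh.
Qed.

Lemma vec_cokernel (c : lin_map (sval Y) (sval Z)) (f : lin_map (sval X) (sval Y)) :
  (forall z, exists y, val c y = z) ->
  (forall y, val c y = 0 <-> exists x, val f x = y) ->
  @is_cokernel _ (vec_cat K) X Y Z c f.
Proof.
move=> cS cf.
suff [fc cU] : lin_comp c f = 0 /\ forall W (g : lin_map (sval Y) W),
    lin_comp g f = 0 -> exists! h : lin_map (sval Z) W, lin_comp h c = g.
  by split=> [|W g]; [exact: fc | exact: (cU (sval W) g)].
split=> [|W g gf0].
  by apply: lin_map_ext => x; apply/cf; exists x.
have [|h [hs hP]] := factor_surj (lin_mapP c) (lin_mapP g) cS.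
  by move=> y /cf[x <-]; exact: (congr1 (fun h : lin_map _ _ => val h x) gf0).
exists (lin_of hs); split; first exact: lin_map_ext.
move=> h' hc; apply: lin_map_ext => z; have [y <-] := cS z.
by rewrite [LHS]hP -hc.
Qed.

Lemma vec_iso (f : lin_map (sval X) (sval Y)) :
  bijective (val f) -> @is_iso _ (vec_cat K) X Y f.
Proof.
case=> g fK gK; have [fD fZ] := lin_mapP f.
have gs : semilinear_for id g.
  by split=> [x y|a x]; apply: (can_inj fK); rewrite ?(fD, fZ) !gK.
exists (lin_of gs).
have [H1 H2] : lin_comp (lin_of gs) f = lin_of (semi_id _) /\
    lin_comp f (lin_of gs) = lin_of (semi_id _) by split; apply: lin_map_ext.
by split; [exact: H1 | exact: H2].
Qed.
End LinearCriteria.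

(** * Phi-modules given by a matrix *)

Section MatrixModule.
Variables (n : nat) (Phi : 'M[E]_n).

Fact mx_phi_semi : semilinear_for sigmaE
  (fun u : 'rV[E]_n => map_mx sigmaE u *m Phi).
Proof.
by split=> [u v|a u]; rewrite ?map_mxD ?mulmxDl ?map_mxZ ?scalemxAl.
Qed.

(** The zero object, kernels, cokernels, biproducts and duals are all built in this form. *)
Definition mx_phimod : phimod T := Phimod mx_phi_semi.

Lemma mx_coords : coords (M := mx_phimod) id id.
Proof. by []. Qed.

Lemma phi_mx_phimod : phi_mx (M := mx_phimod) id id = Phi.
Proof. by apply/row_matrixP=> i; rewrite rowK /= map_delta_mx -rowE. Qed.

Lemma mx_phimod_trivial m P (P' : 'M_(n, m)) :
  mx_trivial Phi^e P P' -> L_trivial mx_phimod.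
Proof.
by rewrite -phi_mx_phimod; apply: mx_L_trivial mx_coords.
Qed.

Variables (M : phimod T) (m : nat).
Variables (f : M -> 'rV[E]_m) (g : 'rV[E]_m -> M).
Hypothesis fg : coords f g.

Lemma hom_of_mx (B : 'M[E]_(n, m)) : Phi *m B = map_mx sigmaE B *m phi_mx f g ->
  exists h : phi_hom mx_phimod M, forall u, phi_fun h u = g (u *m B).
Proof.
move=> hB; have [gD gZ] := coords_semi fg; case: (fg) => _ fK gK.
have hs : semilinear_for id (fun u : mx_phimod => g ((u : 'rV_n) *m B)).
  by split=> [x y|a x]; rewrite ?mulmxDl ?gD // -scalemxAl gZ.
suff hphi (u : mx_phimod) :
    g ((@pm_phi T mx_phimod u : 'rV_n) *m B) = pm_phi (g ((u : 'rV_n) *m B)).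
  by exists (phi_of (M := mx_phimod) hs hphi).
apply: (can_inj fK); rewrite (phi_mxE fg) !gK /=.
by rewrite map_mxM -!mulmxA hB.
Qed.

Lemma hom_to_mx (C : 'M[E]_(m, n)) : phi_mx f g *m C = map_mx sigmaE C *m Phi ->
  exists h : phi_hom M mx_phimod, forall x, phi_fun h x = f x *m C.
Proof.
move=> hC; case: (fg) => -[fD fZ] fK gK.
have hs : semilinear_for id (fun x : M => (f x *m C : mx_phimod)).
  by split=> [x y|a x]; rewrite ?fD ?mulmxDl // fZ -scalemxAl.
suff hphi x : f (pm_phi x) *m C = @pm_phi T mx_phimod (f x *m C).
  by exists (phi_of (N := mx_phimod) hs hphi).
by rewrite (phi_mxE fg) /= map_mxM -!mulmxA hC.
Qed.
End MatrixModule.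

Section HomCommute.
Variables (M N : phimod T) (m n : nat).
Variables (fM : M -> 'rV[E]_m) (gM : 'rV[E]_m -> M).
Variables (fN : N -> 'rV[E]_n) (gN : 'rV[E]_n -> N).
Hypotheses (cM : coords fM gM) (cN : coords fN gN).
Variable h : phi_hom M N.

Lemma phi_hom_mxE x : fN (phi_fun h x) = fM x *m hom_mx gM fN (phi_fun h).
Proof. by rewrite (hom_mxE cM cN (proj1 (phi_homP h))) map_mx_id. Qed.

Lemma hom_mx_phi : phi_mx fM gM *m hom_mx gM fN (phi_fun h) =
  map_mx sigmaE (hom_mx gM fN (phi_fun h)) *m phi_mx fN gN.
Proof.
set A := hom_mx _ _ _; apply/row_matrixP=> i; case: (cM) => _ _ gMK.
have := congr1 fN (proj2 (phi_homP h) (gM (delta_mx 0 i))).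
rewrite (phi_mxE cN) !phi_hom_mxE (phi_mxE cM) gMK map_mxM map_delta_mx.
by rewrite -!mulmxA -!rowE.
Qed.
End HomCommute.

Section KernelCokernel.
Variables (M N : phimod T) (h : phi_hom M N).
Hypotheses (Mt : L_trivial M) (Nt : L_trivial N).

Lemma trivial_kernel_ex : exists (K : phimod T) (k : phi_hom K M),
  [/\ L_trivial K, injective (phi_fun k)
    & forall x, phi_fun h x = 0 <-> exists y, phi_fun k y = x].
Proof.
have /fin_dimP[m [fM [gM cM]]] := proj1 Mt.
have /fin_dimP[n [fN [gN cN]]] := proj1 Nt.
have [jM [P [P' tM]]] := L_trivial_mx cM Mt.
have [jN [R [R' tN]]] := L_trivial_mx cN Nt.
have [d [PhiK [B [Z [A' [[BA BZ AZ] hB [j [Y [Y' tK]]]]]]]]] :=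
  mx_trivial_ker tM tN (hom_mx_phi cM cN h).
have [k kE] := hom_of_mx cM hB.
have hE := phi_hom_mxE cM cN h.
case: (cM) (cN) => _ fMK gMK [fNs fNK gNK].
exists (mx_phimod PhiK), k; split=> [|u v|x].
- exact: mx_phimod_trivial tK.
- rewrite !kE => /(can_inj gMK) /(congr1 (mulmx^~ Z)).
  by rewrite /= -!mulmxA BZ !mulmx1.
- split=> [hx|[u <-]]; last first.
    by apply: (can_inj fNK); rewrite hE kE gMK -mulmxA BA mulmx0 (semi0 fNs).
  exists (fM x *m Z); rewrite kE; apply: (can_inj fMK); rewrite gMK.
  rewrite -[RHS]mulmx1 -AZ mulmxDr !mulmxA -hE hx (semi0 fNs) mul0mx add0r.
  by [].
Qed.

Lemma trivial_cokernel_ex : exists (Q : phimod T) (c : phi_hom N Q),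
  [/\ L_trivial Q, (forall z, exists y, phi_fun c y = z)
    & forall y, phi_fun c y = 0 <-> exists x, phi_fun h x = y].
Proof.
have /fin_dimP[m [fM [gM cM]]] := proj1 Mt.
have /fin_dimP[n [fN [gN cN]]] := proj1 Nt.
have [jM [P [P' tM]]] := L_trivial_mx cM Mt.
have [jN [R [R' tN]]] := L_trivial_mx cN Nt.
have [d [PhiQ [C [W [A' [[AC WC AW] hC [j [Y [Y' tQ]]]]]]]]] :=
  mx_trivial_coker tM tN (hom_mx_phi cM cN h).
have [c cE] := hom_to_mx cN hC.
have hE := phi_hom_mxE cM cN h.
case: (cM) (cN) => _ fMK gMK [fNs fNK gNK].
exists (mx_phimod PhiQ), c; split=> [|z|y].
- exact: mx_phimod_trivial tQ.
- by exists (gN ((z : 'rV_d) *m W)); rewrite cE gNK -mulmxA WC mulmx1.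
- split=> [cy|[x <-]]; last by rewrite cE hE -mulmxA AC mulmx0.
  exists (gM (fN y *m A')); apply: (can_inj fNK); rewrite hE gMK.
  rewrite -[RHS]mulmx1 -AW mulmxDr !mulmxA -cE cy mul0mx addr0.
  by [].
Qed.
End KernelCokernel.

(** * Kernels, monomorphisms and epimorphisms on underlying sets *)

Section LinearCategory.
Variables (K : fieldType) (C : lincat K) (X Y Z : C).

Lemma kernel_mono (k : hom X Y) (f : hom Y Z) : is_kernel k f -> is_mono k.
Proof.
case=> fk kU W g h kgh; have [|u [_ uU]] := kU W (k \oc g).
  rewrite ccompA fk.
  exact: (semi0 (proj2 (semilinear_forP _) (ccomp_linearl g))).
by rewrite -(uU g) // (uU h).
Qed.

Lemma cokernel_epi (c : hom Y Z) (f : hom X Y) : is_cokernel c f -> is_epi c.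
Proof.
case=> cf cU W g h gch; have [|u [_ uU]] := cU W (g \oc c).
  rewrite -ccompA cf.
  exact: (semi0 (proj2 (semilinear_forP _) (ccomp_linearr g))).
by rewrite -(uU g) // (uU h).
Qed.
End LinearCategory.

Section TrivialExactness.
Variables X Y Z : trivial_cat T.

(** The concrete kernel of [f] is itself [L]-trivial, so the universal property of [k] applies to
    it: its inclusion factors through [k], which therefore reaches every element killed by [f]. *)
Lemma kernel_fun (k : phi_hom (sval X) (sval Y)) (f : phi_hom (sval Y) (sval Z)) :
  @is_kernel _ (trivial_cat T) X Y Z k f ->
  forall y, phi_fun f y = 0 <-> exists x, phi_fun k x = y.
Proof.
case=> fk kU y; split=> [fy|[x <-]]; last first.
  exact: (congr1 (fun h : phi_hom _ _ => phi_fun h x) fk).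
have [K [i [Kt iI iE]]] := trivial_kernel_ex f (svalP Y) (svalP Z).
have fi : phi_comp f i = 0.
  by apply: phi_hom_ext => x; apply/iE; exists x.
have [h [hP _]] := kU (exist _ K Kt) i fi.
have /iE[x <-] := fy; exists (@phi_fun T K (sval X) h x).
exact: (congr1 (fun h : phi_hom _ _ => phi_fun h x) hP).
Qed.

(** The inclusion of the concrete kernel of [k] is a legitimate test morphism; it has the same
    composite with [k] as 0, hence is 0. *)
Lemma mono_inj (k : phi_hom (sval X) (sval Y)) :
  @is_mono _ (trivial_cat T) X Y k -> injective (phi_fun k).
Proof.
move=> km; have [K [i [Kt iI iE]]] := trivial_kernel_ex k (svalP X) (svalP Y).
have i0 : i = 0.
  apply: (km (exist _ K Kt) i 0).
  suff E0 : phi_comp k i = phi_comp k 0 by exact: E0.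
  apply: phi_hom_ext => x.
  rewrite [RHS](semi0 (proj1 (phi_homP k))); apply/iE.
  by exists x.
apply: (semi_inj (proj1 (phi_homP k))) => x /iE[y <-].
by rewrite i0.
Qed.

Lemma epi_surj (c : phi_hom (sval Y) (sval Z)) :
  @is_epi _ (trivial_cat T) Y Z c -> forall z, exists y, phi_fun c y = z.
Proof.
move=> ce z; have [Q [q [Qt qS qE]]] := trivial_cokernel_ex c (svalP Y) (svalP Z).
have q0 : q = 0.
  apply: (ce (exist _ Q Qt) q 0).
  suff E0 : phi_comp q c = phi_comp 0 c by exact: E0.
  by apply: phi_hom_ext => x; apply/qE; exists x.
by apply/qE; rewrite q0.
Qed.

Lemma short_exact_fun (f : phi_hom (sval X) (sval Y)) (g : phi_hom (sval Y) (sval Z)) :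
  @short_exact _ (trivial_cat T) X Y Z f g ->
  [/\ injective (phi_fun f), forall z, exists y, phi_fun g y = z
    & forall y, phi_fun g y = 0 <-> exists x, phi_fun f x = y].
Proof.
case=> fg gf; split; last exact: kernel_fun fg.
- exact: mono_inj (kernel_mono fg).
- exact: epi_surj (cokernel_epi gf).
Qed.
End TrivialExactness.

(** * The abelian structure *)

Lemma mx0_trivial : L_trivial (mx_phimod (0 : 'M[E]_0)).
Proof.
suff : mx_trivial (0 : 'M[E]_0)^e (0 : 'M[L]_(0, 0)) 0.
  exact: mx_phimod_trivial.
by split; apply/matrixP=> -[].
Qed.

Lemma phi_compE (M N P : phimod T) (g : phi_hom N P) (f : phi_hom M N) x :
  phi_fun (phi_comp g f) x = phi_fun g (phi_fun f x).
Proof. by []. Qed.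

Lemma phi_biproduct (M N : phimod T) : L_trivial M -> L_trivial N ->
  exists (S : phimod T) (i1 : phi_hom M S) (i2 : phi_hom N S)
    (p1 : phi_hom S M) (p2 : phi_hom S N), L_trivial S /\
  [/\ phi_comp p1 i1 = phi_id M, phi_comp p2 i2 = phi_id N,
      phi_comp p1 i2 = 0, phi_comp p2 i1 = 0
    & phi_comp i1 p1 + phi_comp i2 p2 = phi_id S].
Proof.
move=> Mt Nt.
have /fin_dimP[m [fM [gM cM]]] := proj1 Mt.
have /fin_dimP[n [fN [gN cN]]] := proj1 Nt.
have [jM [P [P' [Ps PP' P'P]]]] := L_trivial_mx cM Mt.
have [jN [R [R' [Rs RR' R'R]]]] := L_trivial_mx cN Nt.
pose Phi := block_mx (phi_mx fM gM) 0 0 (phi_mx fN gN).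
have St : L_trivial (mx_phimod Phi).
  apply: (@mx_phimod_trivial _ _ _ (block_mx P 0 0 R) (block_mx P' 0 0 R')).
  split; rewrite ?map_block_mx ?mulmx_block ?map_mx0 ?(mulmx0, mul0mx, addr0, add0r).
  - by rewrite Ps Rs.
  - by rewrite PP' RR' -scalar_mx_block.
  - by rewrite P'P R'R -scalar_mx_block.
have [i1 i1E] : exists h : phi_hom M (mx_phimod Phi),
    forall x, phi_fun h x = fM x *m row_mx 1%:M 0.
  apply: (hom_to_mx cM); rewrite mul_mx_row mulmx1 mulmx0 map_row_mx map_mx1 map_mx0.
  by rewrite mul_row_block !(mul0mx, mul1mx, addr0).
have [i2 i2E] : exists h : phi_hom N (mx_phimod Phi),
    forall x, phi_fun h x = fN x *m row_mx 0 1%:M.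
  apply: (hom_to_mx cN); rewrite mul_mx_row mulmx1 mulmx0 map_row_mx map_mx1 map_mx0.
  by rewrite mul_row_block !(mul0mx, mul1mx, add0r).
have [p1 p1E] : exists h : phi_hom (mx_phimod Phi) M,
    forall u, phi_fun h u = gM (u *m col_mx 1%:M 0).
  apply: (hom_of_mx cM); rewrite mul_block_col map_col_mx map_mx1 map_mx0 mul_col_mx.
  by rewrite !(mulmx1, mulmx0, mul0mx, mul1mx, addr0).
have [p2 p2E] : exists h : phi_hom (mx_phimod Phi) N,
    forall u, phi_fun h u = gN (u *m col_mx 0 1%:M).
  apply: (hom_of_mx cN); rewrite mul_block_col map_col_mx map_mx1 map_mx0 mul_col_mx.
  by rewrite !(mulmx1, mulmx0, mul0mx, mul1mx, add0r).
have [gMs gNs] := (coords_semi cM, coords_semi cN).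
case: (cM) (cN) => _ fMK gMK [_ fNK gNK].
exists (mx_phimod Phi), i1, i2, p1, p2; split=> //; split; apply: phi_hom_ext => x.
- by rewrite phi_compE i1E p1E -mulmxA mul_row_col mul1mx mul0mx addr0 mulmx1 fMK.
- by rewrite phi_compE i2E p2E -mulmxA mul_row_col mul1mx mul0mx add0r mulmx1 fNK.
- rewrite phi_compE i2E p1E -mulmxA mul_row_col mulmx0 mul0mx addr0 mulmx0.
  exact: (semi0 gMs).
- rewrite phi_compE i1E p2E -mulmxA mul_row_col mulmx0 mul0mx addr0 mulmx0.
  exact: (semi0 gNs).
- change (phi_fun i1 (phi_fun p1 x) + phi_fun i2 (phi_fun p2 x) = x).
  rewrite i1E i2E p1E p2E gMK gNK -!mulmxA -mulmxDr !mul_col_row.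
  rewrite !(mulmx1, mulmx0, mul0mx, mul1mx) add_block_mx !(addr0, add0r).
  by rewrite -scalar_mx_block mulmx1.
Qed.

Lemma trivial_abelian : is_abelian (trivial_cat T).
Proof.
split.
- exists (exist _ _ mx0_trivial); split=> Y f.
    suff E0 : (f : phi_hom (mx_phimod 0) (sval Y)) = 0 by exact: E0.
    apply: phi_hom_ext => x; rewrite (thinmx0 (x : 'rV[E]_0)).
    exact: (semi0 (proj1 (phi_homP (f : phi_hom (mx_phimod 0) (sval Y))))).
  suff E0 : (f : phi_hom (sval Y) (mx_phimod 0)) = 0 by exact: E0.
  by apply: phi_hom_ext => x; apply: thinmx0.
- move=> [M Mt] [N Nt].
  have [S [i1 [i2 [p1 [p2 [St [h1 h2 h3 h4 h5]]]]]]] := phi_biproduct Mt Nt.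
  exists (exist _ S St), i1, i2, p1, p2.
  by split; [exact: h1|exact: h2|exact: h3|exact: h4|exact: h5].
- move=> [M Mt] [N Nt] f.
  have [K [k [Kt kI kE]]] := trivial_kernel_ex (f : phi_hom M N) Mt Nt.
  by exists (exist _ K Kt), k; apply: trivial_kernel.
- move=> [M Mt] [N Nt] f.
  have [Q [c [Qt cS cE]]] := trivial_cokernel_ex (f : phi_hom M N) Mt Nt.
  by exists (exist _ Q Qt), c; apply: trivial_cokernel.
(* A monomorphism is injective, and its image is the kernel of its concrete cokernel; the next case
   is dual. *)
- move=> [M Mt] [N Nt] k /mono_inj kI.
  have [Q [c [Qt cS cE]]] := trivial_cokernel_ex (k : phi_hom M N) Mt Nt.
  by exists (exist _ Q Qt), c; apply: trivial_kernel.
- move=> [M Mt] [N Nt] c /epi_surj cS.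
  have [K [k [Kt kI kE]]] := trivial_kernel_ex (c : phi_hom M N) Mt Nt.
  by exists (exist _ K Kt), k; apply: trivial_cokernel.
Qed.

(** * Tensor products and exactness of V *)

Section UnitFrame.
Let v (i : 'I_1) : Vmod (phi_one T) := V_unit (1 : F^o).

Lemma unit_frame : frame v (fun _ => @tens_runit E L).
Proof.
have [rD rZ] := tens_runit_semi (L : lmodType E).
have v1 i : Vval (v i) = tpure 1 (1 : E^o).
  by rewrite -[in RHS](rmorph1 inc).
split=> [_|_ l t|i j|t].
- exact: rD.
- move: t; apply: tens_ext => [s t|s t|k a].
  + by rewrite lactDr rD.
  + by rewrite rD mulrDr.
  + by rewrite lact_tpure !tens_runit_tpure scalerAr.
- by rewrite v1 tens_runit_tpure scale1r !ord1.
- rewrite big_ord1 v1; move: t; apply: tens_ext => [//|s t|k a].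
    by rewrite rD lactDl.
  rewrite tens_runit_tpure lact_tpure mulr1 tpureZl -tpureZr; congr tpure.
  by rewrite [RHS]mulr1.
Qed.
End UnitFrame.

Lemma phi_one_trivial : L_trivial (phi_one T).
Proof. exact: frame_trivial unit_frame (fin_dim_one E). Qed.

Section TensorFrame.
Variables M N : phimod T.

Lemma V_pair_lactl l s t : V_pair (lact l s) t = lact l (@V_pair T M N s t).
Proof.
have D u := proj1 (V_pairl_semi M (u : tens L N)).
have D' u := proj1 (V_pairr_semi N (u : tens L M)).
move: s; apply: tens_ext => [s s'|s s'|k x]; rewrite ?(lactDr, D) //.
move: t; apply: tens_ext => [t t'|t t'|k' y]; rewrite ?(lactDr, D') //.
by rewrite !(lact_tpure, V_pair_tpure) mulrA.
Qed.

Lemma V_pair_lactr l s t : V_pair s (lact l t) = lact l (@V_pair T M N s t).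
Proof.
have D u := proj1 (V_pairl_semi M (u : tens L N)).
have D' u := proj1 (V_pairr_semi N (u : tens L M)).
move: s; apply: tens_ext => [s s'|s s'|k x]; rewrite ?(lactDr, D) //.
move: t; apply: tens_ext => [t t'|t t'|k' y]; rewrite ?(lactDr, D') //.
by rewrite !(lact_tpure, V_pair_tpure) mulrCA.
Qed.

Section Functionals.
Variables (c : tens L M -> L) (d : tens L N -> L).
Hypotheses (cD : {morph c : s t / s + t}) (cZ : forall l t, c (lact l t) = l * c t).
Hypotheses (dD : {morph d : s t / s + t}) (dZ : forall l t, d (lact l t) = l * d t).

Definition fun_tens : tens M N -> L :=
  tens_lift (fun x y => c (tpure 1 x) * d (tpure 1 y)).

(** The [L]-linear functional induced by [c] and [d] on L (x) (M (x) N), which provides the dual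
    basis of the product frame. It is extended from the elements [tpure 1 x] and [tpure 1 y], first
    over M (x) N, then over [L]. *)
Definition fun_pair : tens L (tens M N) -> L :=
  tens_lift (fun l z => l * fun_tens z).

Fact fun_tens_bal : balanced (fun x y => c (tpure 1 x) * d (tpure 1 y)).
Proof.
split=> [y x x'|x y y'|a x y]; first by rewrite tpureDr cD mulrDl.
  by rewrite tpureDr dD mulrDr.
by rewrite !tpureZr -!lactZ cZ dZ mulrCA mulrA.
Qed.

Fact fun_tens_semi : semilinear_for id fun_tens.
Proof.
apply: tens_lift_semi fun_tens_bal _ => a x y.
by rewrite tpureZr -lactZ cZ -mulrA mulr_algl.
Qed.

Fact fun_pair_bal : balanced (fun (l : L) z => l * fun_tens z).
Proof.
have [D Z] := fun_tens_semi.
split=> [z l l'|l z z'|a l z]; first by rewrite mulrDl.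
  by rewrite D mulrDr.
by rewrite Z -scalerAl scalerAr.
Qed.

Lemma fun_pairD : {morph fun_pair : s t / s + t}.
Proof. exact: tens_liftD fun_pair_bal. Qed.

Lemma fun_pair_tpure l x y :
  fun_pair (tpure l (tpure x y)) = l * (c (tpure 1 x) * d (tpure 1 y)).
Proof.
rewrite /fun_pair tens_lift_tpure; last exact: fun_pair_bal.
by congr (_ * _); apply: tens_lift_tpure fun_tens_bal.
Qed.

Lemma fun_pair_lact l t : fun_pair (lact l t) = l * fun_pair t.
Proof.
move: t; apply: tens_ext => [s t|s t|k z].
- by rewrite lactDr fun_pairD.
- by rewrite fun_pairD mulrDr.
- rewrite lact_tpure /fun_pair !tens_lift_tpure ?mulrA //; exact: fun_pair_bal.
Qed.

Lemma fun_pair_V_pair s t : fun_pair (V_pair s t) = c s * d t.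
Proof.
have D u := proj1 (V_pairl_semi M (u : tens L N)).
have D' u := proj1 (V_pairr_semi N (u : tens L M)).
move: s; apply: tens_ext => [s s'|s s'|k x].
- by rewrite D fun_pairD.
- by rewrite cD mulrDl.
move: t; apply: tens_ext => [t t'|t t'|k' y].
- by rewrite D' fun_pairD.
- by rewrite dD mulrDr.
rewrite V_pair_tpure fun_pair_tpure -[k in RHS]mulr1 -[k' in RHS]mulr1.
by rewrite -!lact_tpure cZ dZ mulrACA.
Qed.
End Functionals.

Variables (I J : finType) (v : I -> Vmod M) (w : J -> Vmod N).
Variables (c : I -> tens L M -> L) (d : J -> tens L N -> L).
Hypotheses (vc : frame v c) (wd : frame w d).

Lemma tens_frame : frame (fun p : I * J => V_mul (v p.1) (w p.2))
  (fun p => fun_pair (c p.1) (d p.2)).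
Proof.
case: vc wd => cD cZ cv cE [dD dZ dw dE].
split=> [p|p l t|[i j] [i' j']|t] /=.
- exact: (fun_pairD (cD _) (cZ _) (dD _) (dZ _)).
- exact: (fun_pair_lact (cD _) (cZ _) (dD _) (dZ _)).
- rewrite Vval_mul (fun_pair_V_pair (cD _) (cZ _) (dD _) (dZ _)) cv dw.
  by rewrite -natrM mulnb -xpair_eqE.
have fD p := fun_pairD (cD p.1) (cZ p.1) (dD p.2) (dZ p.2).
move: t; apply: tens_ext => [//|s t|l z].
  by rewrite -big_split; apply: eq_bigr => p _; rewrite fD lactDl.
move: z; apply: tens_ext => [s t|s t|x y].
- by rewrite tpureDr.
- rewrite tpureDr -big_split; apply: eq_bigr => p _.
  by rewrite fD lactDl.
(* A pure tensor becomes a multiple of a pairing, so that both arguments can be expanded in their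
   frames. *)
have -> : tpure l (tpure x y) = lact l (V_pair (tpure 1 x) (tpure 1 y)).
  by rewrite V_pair_tpure lact_tpure !mulr1.
have E0 (t : tens L M) (t' : tens L N) : V_pair t t' =
    \sum_p lact (c p.1 t * d p.2 t') (Vval (V_mul (v p.1) (w p.2))).
  rewrite [LHS](congr2 _ (cE t) (dE t')) (semi_sum (V_pairl_semi M _)).
  rewrite -(pair_bigA _ (fun i j => lact (c i t * d j t')
    (Vval (V_mul (v i) (w j))))) /=.
  apply: eq_bigr => i _; rewrite (semi_sum (V_pairr_semi N _)).
  by apply: eq_bigr => j _; rewrite V_pair_lactl V_pair_lactr lactM.
rewrite [in LHS]E0 lact_sumr; apply: eq_bigr => p _; rewrite lactM.
rewrite (fun_pair_lact (cD _) (cZ _) (dD _) (dZ _)).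
by rewrite (fun_pair_V_pair (cD _) (cZ _) (dD _) (dZ _)).
Qed.

(** The tensors [tpure (v i) (w j)] span over [F] and are sent to the members of the product frame,
    whose coordinates give injectivity and whose [F]-span is all of V(M (x) N). *)
Lemma V_mu_bij : bijective (tens_lift (@V_mul T M N)).
Proof.
have muD : {morph tens_lift (@V_mul T M N) : s t / s + t}.
  exact: tens_liftD (V_mul_bal M N).
have muE (a : I * J -> F) :
    tens_lift (@V_mul T M N) (\sum_p a p *: tpure (v p.1) (w p.2)) =
    \sum_p a p *: V_mul (v p.1) (w p.2).
  have [_ muZ] := V_mu_semi M N.
  rewrite (semi_sum (V_mu_semi M N)); apply: eq_bigr => p _.
  by rewrite muZ; congr (_ *: _); apply: tens_lift_tpure (V_mul_bal M N).
have span (s : tens (Vmod M) (Vmod N)) :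
    exists a : I * J -> F, s = \sum_p a p *: tpure (v p.1) (w p.2).
  elim/tens_ind: s => [|x y|s t [a ->] [b ->]].
  - by exists (fun _ => 0); rewrite big1 // => p _; rewrite scale0r.
  - have [[a [-> _]] [b [-> _]]] := (frame_fixed vc x, frame_fixed wd y).
    exists (fun p => a p.1 * b p.2).
    rewrite -(pair_bigA _ (fun i j => (a i * b j) *: tpure (v i) (w j))) /=.
    rewrite tpure_suml; apply: eq_bigr => i _; rewrite tpure_sumr.
    by apply: eq_bigr => j _; rewrite tpureZl tpureZr scalerA.
  - exists (fun p => a p + b p); rewrite -big_split.
    by apply: eq_bigr => p _; rewrite scalerDl.
have coef (a : I * J -> F) q : fun_pair (c q.1) (d q.2)
    (Vval (\sum_p a p *: V_mul (v p.1) (w p.2))) = (inc (a q))%:A.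
  rewrite Vval_sum; under eq_bigr do rewrite Vval_scale.
  exact: (frame_comb tens_frame q (fun p => (inc (a p))%:A)).
apply: inj_surj_bij => [s t|x].
  have [[a ->] [b ->]] := (span s, span t); rewrite !muE => ab.
  apply: eq_bigr => p _; congr (_ *: _); apply: inc_alg_inj.
  by rewrite -!coef ab.
have [a [-> _]] := frame_fixed tens_frame x.
by exists (\sum_p a p *: tpure (v p.1) (w p.2)); rewrite muE.
Qed.
End TensorFrame.

Lemma phi_tens_trivial (M N : phimod T) :
  L_trivial M -> L_trivial N -> L_trivial (phi_tens M N).
Proof.
move=> Mt Nt; have [m [v [c vc]]] := L_trivial_frame Mt.
have [n [w [d wd]]] := L_trivial_frame Nt.
apply: frame_trivial (tens_frame vc wd) _.
exact: fin_dim_tens (proj1 Mt) (proj1 Nt).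
Qed.

Lemma V_unit_bij : bijective (@V_unit T).
Proof.
have E1 (a : F) : V_unit a = a *: V_unit (1 : F^o).
  by apply: Vval_inj; rewrite VvalZ -tpureZr; congr tpure; rewrite -{1}[a]mulr1 rmorphM.
apply: inj_surj_bij => [a b ab|x].
  apply: inc_alg_inj; have := congr1 
    (fun w : Vmod (phi_one T) => @tens_runit E L (Vval w)) ab.
  by rewrite /= !tens_runit_tpure.
have [a [-> _]] := frame_fixed unit_frame x; exists (a ord0).
by rewrite big_ord1 E1.
Qed.

(** * Exactness and faithfulness of [V] *)

Section VExact.
Variables (M N P : phimod T) (f : phi_hom M N) (g : phi_hom N P).
Hypotheses (Nt : L_trivial N) (Pt : L_trivial P).
Hypotheses (fI : injective (phi_fun f)).
Hypothesis gS : forall z, exists y, phi_fun g y = z.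
Hypothesis fg : forall y, phi_fun g y = 0 <-> exists x, phi_fun f x = y.

Let fs : semilinear_for id (phi_fun f). Proof. exact: proj1 (phi_homP f). Qed.
Let gs : semilinear_for id (phi_fun g). Proof. exact: proj1 (phi_homP g). Qed.

(** [s] sends a basis of [P] to chosen preimages; [y - s (g y)] then lies in the kernel of [g],
    hence comes from a unique [r y]. Neither map need commute with phi, but the identities persist
    after tensoring with [L]. *)
Lemma split_ex : exists (r : N -> M) (s : P -> N),
  [/\ semilinear_for id r, semilinear_for id s
    & forall y, phi_fun f (r y) + s (phi_fun g y) = y]
  /\ forall x, r (phi_fun f x) = x.
Proof.
have /fin_dimP[n [h [k hk]]] := proj1 Pt.
have [[hD hZ] _ _] := hk.
have /choice[y yP] (i : 'I_n) := gS (k (delta_mx 0 i)).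
pose s z : N := \sum_i h z 0 i *: y i.
have ss : semilinear_for id s.
  split=> [u v|a u].
    rewrite /s -big_split; apply: eq_bigr => i _.
    by rewrite hD mxE scalerDl.
  rewrite /s scaler_sumr; apply: eq_bigr => i _.
  by rewrite hZ mxE scalerA.
have sg z : phi_fun g (s z) = z.
  rewrite (semi_sum gs) [RHS](coords_sum z hk); apply: eq_bigr => i _.
  by rewrite (proj2 gs) yP.
have es : semilinear_for id (fun y => y - s (phi_fun g y)).
  split=> [u v|a u]; first by rewrite (proj1 gs) (proj1 ss) opprD addrACA.
  by rewrite (proj2 gs) (proj2 ss) scalerBr.
have [|r [rs rP]] := factor_inj fs es fI.
  by move=> u; apply/fg; rewrite (semiB gs) sg subrr.
exists r, s; split=> [|x]; first by split=> // u; rewrite rP subrK.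
apply: fI; rewrite rP.
have -> : phi_fun g (phi_fun f x) = 0 by apply/fg; exists x.
by rewrite (semi0 ss) subr0.
Qed.

Lemma V_fun_inj : injective (V_fun f).
Proof.
have [r [s [[rs _ _] rf]]] := split_ex.
move=> v w /(congr1 (fun x => tens_map (@id L) r (Vval x))).
rewrite !Vval_fun; have rfE t : tens_map (@id L) r (tens_map (@id L) (phi_fun f) t) = t.
  move: t; apply: tens_ext => [t t'|//|l x].
    by rewrite (LmapD fs) (LmapD rs).
  by rewrite (Lmap_tpure fs) (Lmap_tpure rs) rf.
by rewrite !rfE => /Vval_inj.
Qed.

Lemma V_fun_ker v : V_fun g v = 0 <-> exists w, V_fun f w = v.
Proof.
have [r [s [[rs ss rsE] rf]]] := split_ex.
have Lf := LmapD fs; have Lg := LmapD gs; have Lr := LmapD rs; have Ls := LmapD ss.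
split=> [/(congr1 (@Vval T P)) gv|[w <-]]; last first.
  apply: Vval_inj; rewrite !Vval_fun; move: (Vval w).
  apply: tens_ext => [t t'|t t'|l x]; first by rewrite Lf Lg.
    by rewrite addr0.
  rewrite (Lmap_tpure fs) (Lmap_tpure gs).
  have -> : phi_fun g (phi_fun f x) = 0 by apply/fg; exists x.
  by rewrite -(scale0r 0) tpureZr scale0r.
pose w := tens_map (@id L) r (Vval v).
have fw : tens_map (@id L) (phi_fun f) w = Vval v.
  have E0 t : tens_map (@id L) (phi_fun f) (tens_map (@id L) r t) +
      tens_map (@id L) s (tens_map (@id L) (phi_fun g) t) = t.
    move: t; apply: tens_ext => [t t'|//|l y].
      by rewrite Lg Lr Lf Ls addrACA.
    by rewrite (Lmap_tpure rs) (Lmap_tpure fs) (Lmap_tpure gs) (Lmap_tpure ss)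
      -tpureDr rsE.
  rewrite -[RHS]E0; move: gv; rewrite Vval_fun => ->.
  by rewrite (semi0 (Lmap_semi ss)) addr0.
have wr : w = tens_map (@id L) r (tens_map (@id L) (phi_fun f) w) by rewrite fw.
have rfE t : tens_map (@id L) r (tens_map (@id L) (phi_fun f) t) = t.
  move: t; apply: tens_ext => [t t'|//|l x]; first by rewrite Lf Lr.
  by rewrite (Lmap_tpure fs) (Lmap_tpure rs) rf.
(* As [r] need not commute with phi, fixedness of [w] is deduced from that of its image [Vval v],
   the base change of [f] being injective. *)
have wfix : phiL w = w.
  rewrite -[LHS]rfE -[RHS]rfE; congr tens_map.
  have phif t : tens_map (@id L) (phi_fun f) (phiL t) =
      phiL (tens_map (@id L) (phi_fun f) t).
    have [pM pN] := (proj1 (phiL_semi M), proj1 (phiL_semi N)).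
    move: t; apply: tens_ext => [t t'|t t'|l x].
    - by rewrite pM Lf.
    - by rewrite Lf pN.
    - by rewrite !(phiL_tpure, Lmap_tpure fs) (proj2 (phi_homP f)).
  by rewrite phif fw VvalP.
by exists (V_of wfix); apply: Vval_inj; rewrite Vval_fun.
Qed.

(* A linear system over F solvable over L is solvable over F. *)
Lemma V_fun_surj w : exists v, V_fun g v = w.
Proof.
have [n [y [c yc]]] := L_trivial_frame Nt.
have [p [z [d zd]]] := L_trivial_frame Pt.
(* [t] lifts [w] over [L] but need not be fixed; it only serves to solve the linear system with
   matrix [A], whose rows are the coordinates of the [V_fun g (y i)]. *)
have [t tw] : exists t, tens_map (@id L) (phi_fun g) t = Vval w.
  elim/tens_ind: (Vval w) => [|l u|s t [s' <-] [t' <-]].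
  - by exists 0; rewrite (semi0 (Lmap_semi gs)).
  - by have [x <-] := gS u; exists (tpure l x); rewrite (Lmap_tpure gs).
  - by exists (s' + t'); rewrite (LmapD gs).
have [a [wE aE]] := frame_fixed zd w.
have /choice[b bP] i := frame_fixed zd (V_fun g (y i)).
pose A : 'M[F]_(n, p) := \matrix_(i, j) b i j.
pose l : 'rV[L]_n := \row_i c i t.
have lA : (\row_j a j)^i = l *m A^i :> 'rV[L]_p.
  apply/rowP=> j; rewrite !mxE -[LHS](aE j) -tw.
  case: (yc) (zd) => _ _ _ cE [dD dZ _ _].
  have d0 : d j 0 = 0 by apply: (addIr (d j 0)); rewrite -dD !add0r.
  rewrite [in LHS](cE t) (semi_sum (Lmap_semi gs)) (big_morph (d j) (dD j) d0).
  apply: eq_bigr => i _; rewrite !mxE (Lmap_lact gs) dZ; congr (_ * _).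
  exact: (proj2 (bP i) j).
(* Solvability over [F] amounts to vanishing against the cokernel matrix of [A], an equation that
   may be checked in [L], where [l] is a solution. *)
have /submxP[u uA] : (\row_j a j <= A)%MS.
  rewrite submxE; apply/eqP/map_inc_inj.
  by rewrite !map_mxM lA -mulmxA -!map_mxM mulmx_coker !map_mx0 mulmx0.
exists (\sum_i u 0 i *: y i).
rewrite wE (semi_sum (V_fun_semi g)).
under eq_bigr do rewrite (proj2 (V_fun_semi g)) (proj1 (bP _)) scaler_sumr.
rewrite exchange_big; apply: eq_bigr => j _ /=.
move/rowP: uA => /(_ j); rewrite !mxE => ->; rewrite scaler_suml.
by apply: eq_bigr => i _; rewrite mxE scalerA.
Qed.
End VExact.

(** Fixed vectors span L (x) M over [L], so [V_fun f] determines every [tpure 1 (f x)], hence [f x]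
    itself. *)
Lemma V_fun_faithful (M N : phimod T) (f g : phi_hom M N) :
  L_trivial M -> L_trivial N -> V_fun f =1 V_fun g -> f = g.
Proof.
move=> Mt Nt fg; apply: phi_hom_ext => x; apply: (tpure1_inj (proj1 Nt)).
have [m [v [c [_ _ _ cE]]]] := L_trivial_frame Mt.
have E0 (h : phi_hom M N) : tpure (1 : L) (phi_fun h x) =
    \sum_i lact (c i (tpure 1 x)) (Vval (V_fun h (v i))).
  have hs := proj1 (phi_homP h).
  rewrite -(Lmap_tpure hs) [in LHS](cE (tpure 1 x)) (semi_sum (Lmap_semi hs)).
  by apply: eq_bigr => i _; rewrite (Lmap_lact hs) Vval_fun.
by rewrite /= !E0; apply: eq_bigr => i _; rewrite fg.
Qed.

(** * The tensor structure *)

Lemma phi_funD (M N : phimod T) (f : phi_hom M N) :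
  {morph phi_fun f : x y / x + y}.
Proof. exact: (proj1 (proj1 (phi_homP f))). Qed.

Lemma phi_tens_ext (M N P : phimod T) (f g : phi_hom (phi_tens M N) P) :
  (forall x y, phi_fun f (tpure x y) = phi_fun g (tpure x y)) -> f = g.
Proof. by move=> fg; apply: phi_hom_ext; exact: (tens_ext (phi_funD f) (phi_funD g) fg). Qed.

Lemma phi_tens_ext3l (M N P Q : phimod T)
    (f g : phi_hom (phi_tens (phi_tens M N) P) Q) :
  (forall x y z, phi_fun f (tpure (tpure x y) z) = phi_fun g (tpure (tpure x y) z)) ->
  f = g.
Proof.
by move=> fg; apply: phi_hom_ext; exact: (tens_ext3l (phi_funD f) (phi_funD g) fg).
Qed.

Lemma phi_tens_ext3r (M N P Q : phimod T)
    (f g : phi_hom (phi_tens M (phi_tens N P)) Q) :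
  (forall x y z, phi_fun f (tpure x (tpure y z)) = phi_fun g (tpure x (tpure y z))) ->
  f = g.
Proof.
by move=> fg; apply: phi_hom_ext; exact: (tens_ext3r (phi_funD f) (phi_funD g) fg).
Qed.

Lemma phi_tmor_tpure (M M' N N' : phimod T) (f : phi_hom M M') (g : phi_hom N N') x y :
  phi_fun (phi_tmor f g) (tpure x y) = tpure (phi_fun f x) (phi_fun g y).
Proof. exact: tens_map_tpure (proj1 (phi_homP f)) (proj1 (phi_homP g)) x y. Qed.

Lemma phi_tens_ext4 (M N P Q R : phimod T)
    (f g : phi_hom (phi_tens (phi_tens (phi_tens M N) P) Q) R) :
  (forall x y z w, phi_fun f (tpure (tpure (tpure x y) z) w) =
                   phi_fun g (tpure (tpure (tpure x y) z) w)) -> f = g.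
Proof.
move=> fg; apply: phi_tens_ext3l => t z w; move: t.
have D (h : phi_hom (phi_tens (phi_tens (phi_tens M N) P) Q) R) s t :
    phi_fun h (tpure (tpure (s + t) z) w) =
    phi_fun h (tpure (tpure s z) w) + phi_fun h (tpure (tpure t z) w).
  by rewrite !tpureDl -phi_funD.
by apply: tens_ext (D f) (D g) _ => x y; apply: fg.
Qed.

Lemma phi_linE (M N : phimod T) (f g : phi_hom M N) a x :
  phi_fun (a *: f + g) x = inc a *: phi_fun f x + phi_fun g x.
Proof. by []. Qed.

Lemma phi_iso (M N : phimod T) (f : phi_hom M N) :
  bijective (phi_fun f) -> @is_iso _ (phi_cat T) M N f.
Proof.
case=> g fK gK; have [[fD fZ] fphi] := phi_homP f.
have gs : semilinear_for id g.
  by split=> [x y|a x]; apply: (can_inj fK); rewrite ?(fD, fZ) !gK.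
have gphi x : g (pm_phi x) = pm_phi (g x).
  by apply: (can_inj fK); rewrite fphi !gK.
by exists (phi_of gs gphi); split; apply: phi_hom_ext.
Qed.

Section ConstraintValues.
Variables M N P : phimod T.
Local Notation S := (phi_tensor T).

Lemma phi_tass_tpure (x : M) (y : N) (z : P) :
  @phi_fun T _ _ (tass S M N P) (tpure (tpure x y) z) = tpure x (tpure y z).
Proof. exact: tens_assoc_tpure. Qed.

Lemma phi_tassV_tpure (x : M) (y : N) (z : P) :
  @phi_fun T _ _ (tassV S M N P) (tpure x (tpure y z)) = tpure (tpure x y) z.
Proof. exact: tens_assocV_tpure. Qed.

Lemma phi_tbraid_tpure (x : M) (y : N) :
  @phi_fun T _ _ (tbraid S M N) (tpure x y) = tpure y x.
Proof. exact: tens_swap_tpure. Qed.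

Lemma phi_tlunit_tpure (a : E^o) (x : M) :
  @phi_fun T _ _ (tlunit S M) (tpure a x) = (a : E) *: x.
Proof. exact: tens_lunit_tpure. Qed.

Lemma phi_trunit_tpure (a : E^o) (x : M) :
  @phi_fun T _ _ (trunit S M) (tpure x a) = (a : E) *: x.
Proof. exact: tens_runit_tpure. Qed.
End ConstraintValues.

Lemma phi_tensor_category : is_tensor_category (phi_tensor T).
Proof.
have E0 := (phi_compE, phi_tmor_tpure, phi_tass_tpure, phi_tassV_tpure,
  phi_tbraid_tpure, phi_tlunit_tpure, phi_trunit_tpure).
split.
- by move=> X Y; apply: phi_tens_ext => x y; rewrite /= E0.
- by move=> X X' X'' Y Y' Y'' f f' g g'; apply: phi_tens_ext => x y; rewrite /= !E0.
- move=> X X' Y Y' g a f f'; apply: phi_tens_ext => x y.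
  by rewrite /= phi_linE !E0 phi_linE tpureDl tpureZl.
- move=> X X' Y Y' f a g g'; apply: phi_tens_ext => x y.
  by rewrite /= phi_linE !E0 phi_linE tpureDr tpureZr.
- by move=> X X' Y Y' Z Z' f g h; apply: phi_tens_ext3l => x y z; rewrite /= !E0.
- by move=> X X' Y Y' f g; apply: phi_tens_ext => x y; rewrite /= !E0.
- move=> X X' f; apply: phi_tens_ext => a x; rewrite /= !E0.
  by rewrite (proj2 (proj1 (phi_homP f))).
- move=> X X' f; apply: phi_tens_ext => x a; rewrite /= !E0.
  by rewrite (proj2 (proj1 (phi_homP f))).
- by move=> X Y Z; apply: phi_tens_ext3l => x y z; rewrite /= !E0.
- by move=> X Y Z; apply: phi_tens_ext3r => x y z; rewrite /= !E0.
- move=> X; apply: phi_iso; exists (tpure (1 : E^o)) => [|x]; last first.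
    by rewrite /= !E0 scale1r.
  apply: tens_ext => [s t|//|a x]; first by rewrite phi_funD tpureDr.
  by rewrite /= !E0 tpureZr -tpureZl; congr tpure; apply: mulr1.
- move=> X; apply: phi_iso; exists (fun x => tpure x (1 : E^o)) => [|x]; last first.
    by rewrite /= !E0 scale1r.
  apply: tens_ext => [s t|//|x a]; first by rewrite phi_funD tpureDl.
  by rewrite /= !E0 tpureZl -tpureZr; congr tpure; apply: mulr1.
- by move=> X Y; apply: phi_tens_ext => x y; rewrite /= !E0.
- by move=> X Y Z W; apply: phi_tens_ext4 => x y z w; rewrite /= !E0.
- move=> X Y; apply: (@phi_tens_ext3l X (phi_one T) Y (phi_tens X Y)) => x a y.
  by rewrite /= !E0 tpureZl tpureZr.
- by move=> X Y Z; apply: phi_tens_ext3l => x y z; rewrite /= !E0.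
Qed.

Section FullSubcategoryTransfer.
Variables (K : fieldType) (C : lincat K) (P : C -> Prop) (S : tensor_data C).
Hypotheses (P1 : P (tone S)) (PM : forall X Y, P X -> P Y -> P (tob S X Y)).

Lemma full_sub_tensor_category :
  is_tensor_category S -> is_tensor_category (full_sub_tensor P1 PM).
Proof.
case=> h1 h2 h3 h4 h5 h6 h7 h8 h9 h10 h11 h12 h13 h14 h15 h16; split.
- by move=> X Y; apply: h1.
- by move=> X X' X'' Y Y' Y'' *; apply: h2.
- by move=> X X' Y Y' g; apply: h3.
- by move=> X X' Y Y' g; apply: h4.
- by move=> X X' Y Y' Z Z' *; apply: h5.
- by move=> X X' Y Y' *; apply: h6.
- by move=> X X' *; apply: h7.
- by move=> X X' *; apply: h8.
- by move=> X Y Z; apply: h9.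
- by move=> X Y Z; apply: h10.
- by move=> X; have [g] := h11 (sval X); exists g.
- by move=> X; have [g] := h12 (sval X); exists g.
- by move=> X Y; apply: h13.
- by move=> X Y Z W; apply: h14.
- by move=> X Y; apply: h15.
- by move=> X Y Z; apply: h16.
Qed.

Lemma full_sub_rigid :
  (forall X, P X -> exists2 Y, P Y & exists (ev : hom (tob S Y X) (tone S))
    (cv : hom (tone S) (tob S X Y)), is_dual ev cv) ->
  is_rigid (full_sub_tensor P1 PM).
Proof.
move=> h [X PX]; have [Y PY [ev [cv [d1 d2]]]] := h X PX.
by exists (exist _ Y PY), ev, cv; split; [exact: d1 | exact: d2].
Qed.
End FullSubcategoryTransfer.

(** * Duals *)

Section Dual.
Variables (M : phimod T) (n : nat) (f : M -> 'rV[E]_n) (g : 'rV[E]_n -> M).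
Hypothesis fg : coords f g.
Local Notation Phi := (phi_mx f g).
Hypothesis Mt : L_trivial M.

(** [P] is not known to be square, but [Phi] is: over [L] it has the right inverse [P' *m P^s], so
    the image in [L] of its determinant is invertible, and the determinant is nonzero in the field
    [E]. *)
Lemma phi_mx_unit : Phi \in unitmx.
Proof.
have [m [P [P' [Ps PP' P'P]]]] := L_trivial_mx fg Mt.
have PhiE : Phi^e = P'^s *m P.
  by rewrite -[in RHS]Ps mulmxA -map_mxM P'P map_mx1 mul1mx.
have : Phi^e *m (P' *m P^s) = 1%:M.
  by rewrite PhiE -mulmxA (mulmxA P) PP' mul1mx -map_mxM P'P map_mx1.
move/(congr1 determinant); rewrite det_mulmx det1 det_map_mx.
rewrite unitmxE unitfE => dP; apply/eqP=> d0.
by move/eqP: dP; rewrite d0 rmorph0 mul0r eq_sym oner_eq0.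
Qed.

(** The contragredient matrix is the one for which the pairing [u *m (f x)^T] commutes with phi. *)
Definition dual_phimod : phimod T := mx_phimod (invmx Phi)^T.

Lemma dual_trivial : L_trivial dual_phimod.
Proof.
have [m [P [P' [Ps PP' P'P]]]] := L_trivial_mx fg Mt.
have P's : P'^s = Phi^e *m P'.
  by rewrite -[LHS]mulmx1 -PP' mulmxA -[X in _ *m X *m _]Ps mulmxA -map_mxM P'P
    map_mx1 mul1mx.
suff : mx_trivial ((invmx Phi)^T)^e P'^T P^T by apply: mx_phimod_trivial.
split; [|by rewrite -trmx_mul PP' trmx1 | by rewrite -trmx_mul P'P trmx1].
rewrite -!map_trmx -trmx_mul P's mulmxA -map_mxM mulVmx ?phi_mx_unit //.
by rewrite map_mx1 mul1mx.
Qed.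

Definition dual_ev_fun : tens dual_phimod M -> E^o :=
  tens_lift (fun (u : 'rV[E]_n) x => ((u *m (f x)^T) 0 0 : E^o)).

Fact dual_ev_bal :
  balanced (fun (u : dual_phimod) x => (((u : 'rV_n) *m (f x)^T) 0 0 : E^o)).
Proof.
have [[fD fZ] _ _] := fg.
split=> [x u v|u x y|a u x]; first by rewrite mulmxDl mxE.
  by rewrite fD linearD mulmxDr mxE.
by rewrite fZ linearZ /= -scalemxAl -scalemxAr.
Qed.

Lemma dual_ev_tpure (u : 'rV[E]_n) x :
  dual_ev_fun (tpure (u : dual_phimod) x) = (u *m (f x)^T) 0 0.
Proof. exact: tens_lift_tpure dual_ev_bal. Qed.

Fact dual_ev_semi : semilinear_for id dual_ev_fun.
Proof.
apply: tens_lift_semi dual_ev_bal _ => a u x.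
by rewrite -scalemxAl mxE.
Qed.

Fact dual_ev_phi t : dual_ev_fun (@pm_phi T (phi_tens dual_phimod M) t) =
  @pm_phi T (phi_one T) (dual_ev_fun t).
Proof.
have D := proj1 dual_ev_semi.
move: t; apply: tens_ext => [s t|s t|u x].
- by rewrite phi_tensD D.
- by rewrite D; apply: rmorphD.
- rewrite phi_tens_tpure !dual_ev_tpure (phi_mxE fg) trmx_mul -mulmxA.
  rewrite (mulmxA _ Phi^T) -trmx_mul mulmxV ?phi_mx_unit // trmx1 mul1mx.
  by rewrite map_trmx -map_mxM mxE.
Qed.

Definition dual_ev : phi_hom (phi_tens dual_phimod M) (phi_one T) :=
  phi_of (M := phi_tens dual_phimod M) (N := phi_one T) dual_ev_semi dual_ev_phi.

(** The canonical element of M (x) M^*, corresponding to the identity of [M]. *)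
Definition dual_elt : tens M dual_phimod :=
  \sum_i tpure (g (delta_mx 0 i)) (delta_mx 0 i : 'rV[E]_n).

(** The sum depends only on [A^T *m B]. phi turns the canonical element into the sum with [A = Phi]
    and [B = (invmx Phi)^T], for which this product is 1; hence the element is fixed. *)
Lemma tpure_row_sum (A B : 'M[E]_n) :
  \sum_i tpure (g (row i A)) (row i B : dual_phimod) =
  \sum_i tpure (g (delta_mx 0 i)) (row i (A^T *m B) : dual_phimod).
Proof.
have gs := coords_semi fg.
have -> : \sum_i tpure (g (row i A)) (row i B : dual_phimod) =
    \sum_i \sum_j tpure (g (delta_mx 0 j)) (A i j *: row i B : dual_phimod).
  apply: eq_bigr => i _; rewrite (row_sum_delta (row i A)) (semi_sum gs).
  rewrite tpure_suml; apply: eq_bigr => j _.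
  by rewrite (proj2 gs) tpureZl tpureZr mxE.
rewrite exchange_big; apply: eq_bigr => j _; rewrite -tpure_sumr; congr tpure.
rewrite row_mul mulmx_sum_row; apply: eq_bigr => i _.
by rewrite !mxE.
Qed.

Fact dual_elt_phi : @pm_phi T (phi_tens M dual_phimod) dual_elt = dual_elt.
Proof.
have fK : cancel f g by case: fg.
have gK : cancel g f by case: fg.
rewrite /dual_elt (semi_sum (pm_phiP (phi_tens M dual_phimod))).
transitivity (\sum_i tpure (g (row i Phi)) (row i (invmx Phi)^T : dual_phimod)).
  apply: eq_bigr => i _; rewrite phi_tens_tpure; congr tpure.
    by apply: (can_inj fK); rewrite (phi_mxE fg) !gK map_delta_mx -rowE.
  by rewrite /= map_delta_mx -rowE.
rewrite tpure_row_sum; apply: eq_bigr => i _; congr tpure.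
by rewrite -trmx_mul mulVmx ?phi_mx_unit // trmx1 row1.
Qed.

Fact dual_cv_semi : semilinear_for id (fun a : E^o => (a : E) *: dual_elt).
Proof. by split=> [a b|a b]; rewrite ?scalerDl ?scalerA. Qed.

Fact dual_cv_phi (a : E^o) : (@pm_phi T (phi_one T) a : E) *: dual_elt =
  @pm_phi T (phi_tens M dual_phimod) ((a : E) *: dual_elt).
Proof. by rewrite (proj2 (pm_phiP (phi_tens M dual_phimod))) dual_elt_phi. Qed.

Definition dual_cv : phi_hom (phi_one T) (phi_tens M dual_phimod) :=
  phi_of (M := phi_one T) (N := phi_tens M dual_phimod) dual_cv_semi dual_cv_phi.

Lemma phi_fun_sum (A B : phimod T) (h : phi_hom A B) (I : finType) (x : I -> A) :
  phi_fun h (\sum_i x i) = \sum_i phi_fun h (x i).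
Proof. exact: (semi_sum (proj1 (phi_homP h))). Qed.

Lemma phi_fun_scale (A B : phimod T) (h : phi_hom A B) a (x : A) :
  phi_fun h (a *: x) = a *: phi_fun h x.
Proof. exact: (proj2 (proj1 (phi_homP h))). Qed.

Lemma phi_is_dual : @is_dual _ (phi_cat T) (phi_tensor T) M dual_phimod dual_ev dual_cv.
Proof.
have cvE (a : E^o) : phi_fun dual_cv a = (a : E) *: dual_elt by [].
have evE u x : phi_fun dual_ev (tpure u x) = ((u : 'rV_n) *m (f x)^T) 0 0.
  exact: dual_ev_tpure.
have deltaf i x : ((delta_mx 0 i : 'rV_n) *m (f x)^T) 0 0 = f x 0 i.
  by rewrite -rowE !mxE.
split.
- apply: phi_tens_ext => a x; rewrite phi_tlunit_tpure /=.
  rewrite !phi_compE phi_tmor_tpure cvE tpureZl !phi_fun_scale; congr (_ *: _).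
  rewrite tpure_suml !phi_fun_sum [RHS](coords_sum x fg); apply: eq_bigr => i _.
  rewrite phi_tass_tpure phi_tmor_tpure phi_trunit_tpure evE.
  by rewrite deltaf.
- apply: phi_tens_ext => u a; rewrite phi_trunit_tpure /=.
  rewrite !phi_compE phi_tmor_tpure cvE tpureZr !phi_fun_scale; congr (_ *: _).
  rewrite tpure_sumr !phi_fun_sum [RHS](row_sum_delta (u : 'rV_n)).
  apply: eq_bigr => i _.
  rewrite phi_tassV_tpure phi_tmor_tpure phi_tlunit_tpure evE.
  case: fg => _ _ gK; rewrite gK trmx_delta.
  by rewrite -colE mxE.
Qed.
End Dual.

Lemma trivial_rigid T1 TM : is_rigid (trivial_tensor (T := T) T1 TM).
Proof.
apply: full_sub_rigid => M Mt; have /fin_dimP[n [f [g fg]]] := proj1 Mt.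
exists (dual_phimod f g); first exact: dual_trivial.
by exists (dual_ev fg Mt), (dual_cv fg Mt); apply: phi_is_dual.
Qed.

(** * The fiber functor *)

Section FiberFunctorAxioms.
Implicit Types M N P : phimod T.

Local Notation Lphi f := (tens_map (@id L) (phi_fun f)).

Lemma Lphi_tpure M N (f : phi_hom M N) l x :
  Lphi f (tpure l x) = tpure l (phi_fun f x).
Proof. exact: Lmap_tpure (proj1 (phi_homP f)) l x. Qed.

Lemma LphiD M N (f : phi_hom M N) : {morph Lphi f : s t / s + t}.
Proof. exact: LmapD (proj1 (phi_homP f)). Qed.

Lemma V_pairDl M N (t : tens L N) :
  {morph (fun s : tens L M => V_pair s t) : s s' / s + s'}.
Proof. exact: (proj1 (V_pairl_semi M t)). Qed.

Lemma V_pairDr M N (s : tens L M) :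
  {morph (fun t : tens L N => V_pair s t) : t t' / t + t'}.
Proof. exact: (proj1 (V_pairr_semi N s)). Qed.

Lemma V_fun_lin M N : linear (@V_fun T M N).
Proof.
move=> a f g; apply/funext=> v; apply: Vval_inj.
rewrite Vval_fun [RHS]/(inc a *: Lphi f (Vval v) + Lphi g (Vval v)).
move: (Vval v); apply: tens_ext => [s t|s t|l x].
- exact: LphiD.
- by rewrite !LphiD scalerDr addrACA.
- by rewrite !Lphi_tpure phi_linE tpureDr tpureZr.
Qed.

Lemma V_mul_natural M M' N N' (f : phi_hom M M') (g : phi_hom N N') v w :
  V_fun (phi_tmor f g) (V_mul v w) = V_mul (V_fun f v) (V_fun g w).
Proof.
apply: Vval_inj; rewrite Vval_fun !Vval_mul !Vval_fun.
move: (Vval v) (Vval w) => s t; move: s; apply: tens_ext => [s s'|s s'|l x].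
- by rewrite V_pairDl LphiD.
- by rewrite LphiD V_pairDl.
move: t; apply: tens_ext => [t t'|t t'|l' y].
- by rewrite V_pairDr LphiD.
- by rewrite LphiD V_pairDr.
by rewrite !(Lphi_tpure, V_pair_tpure) phi_tmor_tpure.
Qed.

Lemma V_mul_assoc M N P (u : Vmod M) (v : Vmod N) (w : Vmod P) :
  V_fun (tass (phi_tensor T) M N P) (V_mul (V_mul u v) w) =
  V_mul u (V_mul v w).
Proof.
apply: Vval_inj; rewrite Vval_fun !Vval_mul.
move: (Vval u) (Vval v) (Vval w) => r s t.
move: r; apply: tens_ext => [r r'|r r'|k x].
- by rewrite !V_pairDl LphiD.
- by rewrite V_pairDl.
move: s; apply: tens_ext => [s s'|s s'|l y].
- by rewrite V_pairDr V_pairDl LphiD.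
- by rewrite V_pairDl V_pairDr.
move: t; apply: tens_ext => [t t'|t t'|l' z].
- by rewrite V_pairDr LphiD.
- by rewrite !V_pairDr.
by rewrite !V_pair_tpure Lphi_tpure phi_tass_tpure mulrA.
Qed.

Lemma V_mul_braid M N (v : Vmod M) (w : Vmod N) :
  V_fun (tbraid (phi_tensor T) M N) (V_mul v w) = V_mul w v.
Proof.
apply: Vval_inj; rewrite Vval_fun !Vval_mul.
move: (Vval v) (Vval w) => s t; move: s; apply: tens_ext => [s s'|s s'|l x].
- by rewrite V_pairDl LphiD.
- by rewrite V_pairDr.
move: t; apply: tens_ext => [t t'|t t'|l' y].
- by rewrite V_pairDr LphiD.
- by rewrite V_pairDl.
by rewrite !V_pair_tpure Lphi_tpure phi_tbraid_tpure mulrC.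
Qed.

Lemma Vval_unit (a : F) : Vval (V_unit (a : F^o)) = tpure 1 (inc a : E^o).
Proof. by []. Qed.

Lemma V_mul_lunit M (a : F) (v : Vmod M) :
  V_fun (tlunit (phi_tensor T) M) (V_mul (V_unit (a : F^o)) v) = a *: v.
Proof.
apply: Vval_inj; rewrite Vval_fun Vval_mul Vval_unit VvalZ.
move: (Vval v); apply: tens_ext => [s t|s t|l x].
- by rewrite V_pairDr LphiD.
- by rewrite scalerDr.
by rewrite V_pair_tpure Lphi_tpure phi_tlunit_tpure mul1r tpureZr.
Qed.

Lemma V_mul_runit M (a : F) (v : Vmod M) :
  V_fun (trunit (phi_tensor T) M) (V_mul v (V_unit (a : F^o))) = a *: v.
Proof.
apply: Vval_inj; rewrite Vval_fun Vval_mul Vval_unit VvalZ.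
move: (Vval v); apply: tens_ext => [s t|s t|l x].
- by rewrite V_pairDl LphiD.
- by rewrite scalerDr.
by rewrite V_pair_tpure Lphi_tpure phi_trunit_tpure mulr1 tpureZr.
Qed.

Local Notation mu M N := (tens_lift (@V_mul T M N)).

Lemma V_mu_tpure M N v w : mu M N (tpure v w) = V_mul v w.
Proof. exact: tens_lift_tpure (V_mul_bal M N). Qed.

End FiberFunctorAxioms.

Lemma lin_tens_ext (K : fieldType) (A B C : lmodType K) (f g : lin_map (tens A B) C) :
  (forall x y, val f (tpure x y) = val g (tpure x y)) -> f = g.
Proof.
move=> fg; apply: lin_map_ext.
exact: tens_ext (proj1 (lin_mapP f)) (proj1 (lin_mapP g)) fg.
Qed.

Lemma lin_tens_ext3 (K : fieldType) (A B C D : lmodType K)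
    (f g : lin_map (tens (tens A B) C) D) :
  (forall x y z, val f (tpure (tpure x y) z) = val g (tpure (tpure x y) z)) -> f = g.
Proof.
move=> fg; apply: lin_map_ext.
exact: tens_ext3l (proj1 (lin_mapP f)) (proj1 (lin_mapP g)) fg.
Qed.

Lemma lin_ofE (K : fieldType) (A B : lmodType K) (f : A -> B) fs x :
  val (@lin_of K A B f fs) x = f x.
Proof. by []. Qed.

Lemma lin_compE (K : fieldType) (A B C : lmodType K) (g : lin_map B C)
    (f : lin_map A B) x : val (lin_comp g f) x = val g (val f x).
Proof. by []. Qed.

Section FiberFunctor.
Hypothesis T1 : L_trivial (phi_one T).
Hypothesis TM : forall M N : phimod T,
  L_trivial M -> L_trivial N -> L_trivial (phi_tens M N).
Hypothesis TV : forall M : phimod T, L_trivial M -> fin_dim (Vmod M).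

Lemma trivial_V_tensor : is_tensor_functor (trivial_V T1 TM TV).
Proof.
have lt (K : fieldType) (A A' B B' : lmodType K) (f : lin_map A A') (g : lin_map B B') x y :
    tens_map (val f) (val g) (tpure x y) = tpure (val f x) (val g y).
  exact: tens_map_tpure (lin_mapP f) (lin_mapP g) x y.
split.
- move=> [M Mt] [N Nt]; apply: vec_iso.
  have [m [v [c vc]]] := L_trivial_frame Mt.
  have [n [w [d wd]]] := L_trivial_frame Nt.
  exact: (V_mu_bij vc wd).
- by apply: vec_iso; apply: V_unit_bij.
- move=> [M Mt] [M' M't] [N Nt] [N' N't] f g.
  suff E0 : lin_comp (lin_of (V_mu_semi M' N'))
      (lin_of (tens_map_semi (lin_mapP (lin_of (V_fun_semi (f : phi_hom M M'))))
        (lin_mapP (lin_of (V_fun_semi (g : phi_hom N N')))))) =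
    lin_comp (lin_of (V_fun_semi (phi_tmor (f : phi_hom M M') (g : phi_hom N N'))))
      (lin_of (V_mu_semi M N)) by exact: E0.
  apply: lin_tens_ext => v w; rewrite !lin_compE !lin_ofE V_mu_tpure V_mul_natural.
  by rewrite lt !lin_ofE V_mu_tpure.
- move=> [M Mt] [N Nt] [P Pt].
  pose i (M : phimod T) := lin_of (semi_id (Vmod M)).
  pose mu (M N : phimod T) := lin_of (V_mu_semi M N).
  suff E0 : lin_comp (lin_comp (lin_of (V_fun_semi (tass (phi_tensor T) M N P)))
      (mu (phi_tens M N) P)) (lin_of (tens_map_semi (lin_mapP (mu M N)) (lin_mapP (i P)))) =
    lin_comp (lin_comp (mu M (phi_tens N P))
      (lin_of (tens_map_semi (lin_mapP (i M)) (lin_mapP (mu N P)))))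
      (lin_of (tens_assoc_semi (Vmod M) (Vmod N) (Vmod P))) by exact: E0.
  apply: lin_tens_ext3 => u v w; rewrite !lin_compE !lin_ofE tens_assoc_tpure.
  by rewrite !lt !lin_ofE !V_mu_tpure V_mul_assoc.
- move=> [M Mt] [N Nt].
  suff E0 : lin_comp (lin_of (V_fun_semi (tbraid (phi_tensor T) M N)))
      (lin_of (V_mu_semi M N)) =
    lin_comp (lin_of (V_mu_semi N M)) (lin_of (tens_swap_semi (Vmod M) (Vmod N)))
    by exact: E0.
  apply: lin_tens_ext => v w; rewrite !lin_compE !lin_ofE tens_swap_tpure.
  by rewrite !V_mu_tpure V_mul_braid.
- move=> [M Mt].
  suff E0 : lin_comp (lin_comp (lin_of (V_fun_semi (tlunit (phi_tensor T) M)))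
      (lin_of (V_mu_semi (phi_one T) M)))
      (lin_of (tens_map_semi (lin_mapP (lin_of (V_unit_semi T)))
        (lin_mapP (lin_of (semi_id (Vmod M)))))) =
    lin_of (tens_lunit_semi (Vmod M)) by exact: E0.
  apply: lin_tens_ext => a v; rewrite !lin_compE !lin_ofE tens_lunit_tpure.
  by rewrite !lt !lin_ofE !V_mu_tpure V_mul_lunit.
- move=> [M Mt].
  suff E0 : lin_comp (lin_comp (lin_of (V_fun_semi (trunit (phi_tensor T) M)))
      (lin_of (V_mu_semi M (phi_one T))))
      (lin_of (tens_map_semi (lin_mapP (lin_of (semi_id (Vmod M))))
        (lin_mapP (lin_of (V_unit_semi T))))) =
    lin_of (tens_runit_semi (Vmod M)) by exact: E0.
  apply: lin_tens_ext => v a; rewrite !lin_compE !lin_ofE tens_runit_tpure.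
  by rewrite !lt !lin_ofE !V_mu_tpure V_mul_runit.
Qed.

Lemma trivial_V_fiber : is_fiber_functor (trivial_V T1 TM TV).
Proof.
split; last exact: trivial_V_tensor.
- move=> [M Mt] [N Nt] [P Pt] f g sfg.
  have [fI gS fg] : [/\ injective (phi_fun (f : phi_hom M N)),
      forall z, exists y, phi_fun (g : phi_hom N P) y = z
    & forall y, phi_fun (g : phi_hom N P) y = 0 <->
        exists x, phi_fun (f : phi_hom M N) x = y].
    exact: (@short_exact_fun (exist _ M Mt) (exist _ N Nt) (exist _ P Pt) _ _ sfg).
  have Vk := V_fun_ker Pt fI gS fg.
  split.
    by apply: vec_kernel; [exact: V_fun_inj Pt fI gS fg | exact: Vk].
  by apply: vec_cokernel; [exact: V_fun_surj Nt Pt gS | exact: Vk].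
- move=> [M Mt] [N Nt] f g fg.
  apply: (V_fun_faithful Mt Nt) => v.
  exact: (congr1 (fun h : lin_map _ _ => val h v) fg).
- move=> [M Mt] [N Nt] a f g; apply: lin_map_ext => v.
  exact: (congr1 (fun h => h v) (V_fun_lin a f g)).
Qed.

(** An endomorphism of the unit is multiplication by the image of 1, which is fixed because 1 is,
    and so comes from [F]. *)
Lemma trivial_end_one :
  bijective (fun a : F => a *: idm (tone (trivial_tensor T1 TM))).
Proof.
suff E0 : bijective (fun a : F => a *: phi_id (phi_one T)) by exact: E0.
have idE (a : F) : phi_fun (a *: phi_id (phi_one T)) (1 : E^o) = inc a.
  by rewrite -[RHS]mulr1.
apply: inj_surj_bij => [a b ab|h].
  by apply: (fmorph_inj inc); rewrite -!idE ab.
have [[hD hZ] hphi] := phi_homP h.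
have [a ha] : exists a, phi_fun h (1 : E^o) = inc a.
  apply/st_fixE; rewrite -[LHS](hphi (1 : E^o)); congr (phi_fun h).
  exact: rmorph1.
exists a; apply: phi_hom_ext => x.
have xE : x = (x : E) *: (1 : E^o) by rewrite -[LHS]mulr1.
by rewrite xE hZ ha -idE phi_fun_scale.
Qed.
End FiberFunctor.
End SigmaTriple.

Theorem theorem3p22 (T : sigma_triple) :
  exists (T1 : L_trivial (phi_one T))
         (TM : forall M N : phimod T,
                 L_trivial M -> L_trivial N -> L_trivial (phi_tens M N))
         (TV : forall M : phimod T, L_trivial M -> fin_dim (Vmod M)),
    is_neutral_tannakian (trivial_tensor T1 TM) /\
    is_fiber_functor (trivial_V T1 TM TV).
Proof.
exists (phi_one_trivial T), (@phi_tens_trivial T), (@L_trivial_Vfin_dim T).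
split; last exact: trivial_V_fiber.
split.
- exact: full_sub_tensor_category (phi_tensor_category T).
- exact: trivial_rigid.
- exact: trivial_abelian.
- exact: trivial_end_one.
- by exists (trivial_V (phi_one_trivial T) (@phi_tens_trivial T)
    (@L_trivial_Vfin_dim T)); apply: trivial_V_fiber.
Qed.
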